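(* Consider a robust MDP $(\mathcal{S},\mathcal{A},\boldsymbol{r},\mathcal{U},\boldsymbol{p}_0)$ with an sa-rectangular compact uncertainty set $\mathcal{U}$. There exists a discount factor $\gamma_{\sf avg}\in[0,1)$ such that, for every $\gamma\in(\gamma_{\sf avg},1)$, any stationary deterministic policy that is discount optimal for $\gamma$ is also average optimal.
   Context: A robust MDP (RMDP) is a tuple $(\mathcal{S},\mathcal{A},\boldsymbol{r},\mathcal{U},\boldsymbol{p}_0)$: $\mathcal{S}$ (states) and $\mathcal{A}$ (actions) are finite nonempty sets, $\boldsymbol{r}\in\mathbb{R}^{\mathcal{S}\times\mathcal{A}\times\mathcal{S}}$ is the reward function, the uncertainty set $\mathcal{U}\subset\Delta(\mathcal{S})^{\mathcal{S}\times\mathcal{A}}$ is a nonempty compact set of transition probabilities $\boldsymbol{P}=(\boldsymbol{p}_{sa})_{s,a}$, and $\boldsymbol{p}_0\in\Delta(\mathcal{S})$ is the initial distribution. The set $\mathcal{U}$ is sa-rectangular if $\mathcal{U}=\prod_{(s,a)}\mathcal{U}_{sa}$ with $\mathcal{U}_{sa}\subseteq\Delta(\mathcal{S})$. $\Pi_{\sf H}$ is the set of history-dependent, possibly randomized policies (the distribution of $a_t$ may depend on $(s_0,a_0,\dots,s_t)$). $\mathbb{E}_{\pi,\boldsymbol{P}}$ is expectation with respect to the law of $(s_t,a_t)_{t\ge 0}$ induced by $\pi$ and $\boldsymbol{P}$. Discounted return and average return: $$R_\gamma(\pi,\boldsymbol{P})=\mathbb{E}_{\pi,\boldsymbol{P}}\Big[\sum_{t=0}^{+\infty}\gamma^t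 r_{s_ta_ts_{t+1}}\Big|s_0\sim\boldsymbol{p}_0\Big],\qquad R_{\sf avg}(\pi,\boldsymbol{P})=\mathbb{E}_{\pi,\boldsymbol{P}}\Big[\limsup_{T\to+\infty}\tfrac{1}{T+1}\sum_{t=0}^{T} r_{s_ta_ts_{t+1}}\Big|s_0\sim\boldsymbol{p}_0\Big].$$ A policy is discount optimal for $\gamma$ if it attains $\sup_{\pi\in\Pi_{\sf H}}\min_{\boldsymbol{P}\in\mathcal{U}}R_\gamma(\pi,\boldsymbol{P})$, and average optimal if it attains $\sup_{\pi\in\Pi_{\sf H}}\inf_{\boldsymbol{P}\in\mathcal{U}}R_{\sf avg}(\pi,\boldsymbol{P})$. *)

(* Defs.v *)
From HB Require Import structures.
From mathcomp Require Import all_boot all_order all_algebra.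
From mathcomp Require Import all_classical all_reals all_analysis.

Set Implicit Arguments.
Unset Strict Implicit.
Unset Printing Implicit Defensive.

Import Order.TTheory GRing.Theory Num.Theory.
Import numFieldNormedType.Exports.

Local Open Scope classical_set_scope.
Local Open Scope ring_scope.

(* A nonempty finite set is a finType with a distinguished point, so that sets
   of trajectories are pointed, as [measurableType] requires. *)
#[short(type="finPointedType")]
HB.structure Definition FinPointed := {T of Finite T & isPointed T}.

HB.instance Definition _ (S A : finPointedType) := Finite.on (S * A)%type.

Record fdist (R : realType) (T : finType) := FDist {
  fpmf :> T -> R;
  fpmf_ge0 : forall x, 0 <= fpmf x;
  fpmf_sum1 : \sum_x fpmf x = 1 }.

Section fdist_constructions.
Context (R : realType).

Lemma fdirac_ge0 (T : finType) (y x : T) : 0 <= (x == y)%:R :> R.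
Proof. exact: ler0n. Qed.

Lemma fdirac_sum1 (T : finType) (y : T) : \sum_x (x == y)%:R = 1 :> R.
Proof.
by rewrite (bigD1 y)//= eqxx big1 ?addr0// => x /negbTE ->.
Qed.

Definition fdirac (T : finType) (y : T) : fdist R T :=
  FDist (@fdirac_ge0 T y) (fdirac_sum1 y).

Lemma fpair_ge0 (T U : finType) (d : fdist R T) (k : T -> fdist R U)
  (x : T * U) : 0 <= d x.1 * k x.1 x.2.
Proof. by rewrite mulr_ge0// fpmf_ge0. Qed.

Lemma fpair_sum1 (T U : finType) (d : fdist R T) (k : T -> fdist R U) :
  \sum_(x : T * U) d x.1 * k x.1 x.2 = 1.
Proof.
rewrite -(pair_bigA _ (fun x y => d x * k x y))/= -(fpmf_sum1 d).
by apply: eq_bigr => x _; rewrite -mulr_sumr fpmf_sum1 mulr1.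
Qed.

Definition fpair (T U : finType) (d : fdist R T) (k : T -> fdist R U) :
  fdist R (T * U)%type := FDist (fpair_ge0 d k) (fpair_sum1 d k).

End fdist_constructions.

Definition cylinder (X : Type) (w : nat -> X) (n : nat) : set (nat -> X) :=
  [set w' | forall t, (t < n)%N -> w' t = w t].

Definition cylinders (X : Type) : set (set (nat -> X)) :=
  [set C | exists w n, C = cylinder w n].

Definition traj (X : pointedType) := g_sigma_algebraType (@cylinders X).

Lemma measurable_cylinder (X : pointedType) (w : nat -> X) (n : nat) :
  measurable (cylinder w n : set (traj X)).
Proof. by apply: sub_sigma_algebra; exists w, n. Qed.

(* Existence of the law of a process whose coordinate of index t has
   conditional distribution [c (w_0 ... w_{t-1})]: it is realized as the image
   of the Lebesgue measure on [0, 1[ by a subdivision into nested intervals. *)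
Section process_law.
Context (R : realType) (X : finPointedType).
Variable c : seq X -> fdist R X.
Implicit Types (r : seq X) (x y : X) (u : R) (n : nat).

Let cum r n := \sum_(y | (enum_rank y < n)%N) c (rev r) y.

(* words are listed from the last letter to the first one *)
Let q := fix q r := if r is x :: r' then q r' * c (rev r') x else 1.
Let lo := fix lo r :=
  if r is x :: r' then lo r' + q r' * cum r' (enum_rank x) else 0.

Let q_ge0 r : 0 <= q r.
Proof. by elim: r => [|x r IH] /=; rewrite ?ler01// mulr_ge0// fpmf_ge0. Qed.

Let cum0 r : cum r 0 = 0.
Proof. by rewrite /cum big_pred0. Qed.

Let cumT r : cum r #|X| = 1.
Proof.
rewrite -(fpmf_sum1 (c (rev r))); apply: eq_bigl => y.
by rewrite ltn_ord.
Qed.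

Let cumS r x : cum r (enum_rank x).+1 = cum r (enum_rank x) + c (rev r) x.
Proof.
rewrite /cum (bigD1 x)//= addrC; congr (_ + _); apply: eq_bigl => y.
by rewrite ltnS ltn_neqAle andbC (inj_eq (@ord_inj _)) (inj_eq enum_rank_inj).
Qed.

Let le_cum r m n : (m <= n)%N -> cum r m <= cum r n.
Proof.
move=> mn; rewrite /cum big_mkcond [leRHS]big_mkcond/=.
apply: ler_sum => y _; case: ifP => [ym|_]; first by rewrite (leq_trans ym).
by case: ifP => // _; exact: fpmf_ge0.
Qed.

Let mem r u := lo r <= u < lo r + q r.

Let mem_cons x r u : mem (x :: r) u =
  (lo r + q r * cum r (enum_rank x) <= u < lo r + q r * cum r (enum_rank x).+1).
Proof. by rewrite /mem /= cumS mulrDr addrA. Qed.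

Let mem_tail x r u : mem (x :: r) u -> mem r u.
Proof.
rewrite mem_cons /mem => /andP[h1 h2]; apply/andP; split.
  by apply: le_trans h1; rewrite lerDl mulr_ge0// -(cum0 r) le_cum.
apply: lt_le_trans h2 _; rewrite lerD2l -[leRHS]mulr1 ler_wpM2l// -(cumT r).
by rewrite le_cum// ltn_ord.
Qed.

Let mem_inj x y r u : mem (x :: r) u -> mem (y :: r) u -> x = y.
Proof.
have H a b : mem (a :: r) u -> mem (b :: r) u ->
    (enum_rank a < enum_rank b)%N -> False.
  rewrite !mem_cons => /andP[_ h1] /andP[h2 _] ab.
  have := lt_le_trans (le_lt_trans h2 h1) (lexx _).
  by rewrite ltrD2l ltNge ler_wpM2l// le_cum.
move=> mx my; apply: enum_rank_inj; apply: ord_inj.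
by case: (ltngtP (enum_rank x) (enum_rank y)) => // h; exfalso; apply: H h.
Qed.

Let mem_ex r u : mem r u -> exists x, mem (x :: r) u.
Proof.
move=> /andP[h1 h2].
have ex : exists n, u < lo r + q r * cum r n.
  by exists #|X|; rewrite cumT mulr1.
case: (ex_minnP ex) => -[|n]; first by rewrite cum0 mulr0 addr0 ltNge h1.
move=> hn minn.
have nX : (n < #|X|)%N by apply: minn; rewrite cumT mulr1.
exists (enum_val (Ordinal nX)); rewrite mem_cons enum_valK /= hn andbT leNgt.
by apply/negP => /minn; rewrite ltnn.
Qed.

Let nxt u r : X := odflt point [pick x | mem (x :: r) u].
Let word u := fix word n :=
  if n is m.+1 then nxt u (word m) :: word m else [::].

Let wordP u r : 0 <= u < 1 -> (word u (size r) = r) <-> mem r u.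
Proof.
move=> u01; elim: r => [|x r IH] /=; first by rewrite /mem/= add0r u01.
split => [[nx /IH mr]|mx].
  move: nx; rewrite (IH.2 mr) /nxt; case: pickP => /= [y my <-//|no].
  by have [y] := mem_ex mr; rewrite no.
rewrite (IH.2 (mem_tail mx)); congr (_ :: _); rewrite /nxt.
by case: pickP => /= [y my|/(_ x)]; [exact: mem_inj my mx|rewrite mx].
Qed.

Let coding u : traj X := fun n =>
  if 0 <= u < 1 then nxt u (word u n) else point.

Let rev_mkseq (w : nat -> X) n : rev (mkseq w n.+1) = w n :: rev (mkseq w n).
Proof. by rewrite /mkseq -addn1 iotaD map_cat rev_cat. Qed.

Let word_coding u n : 0 <= u < 1 -> word u n = rev (mkseq (coding u) n).
Proof.
move=> u01; elim: n => [//|n IH].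
by rewrite rev_mkseq -IH /= [in RHS]/coding u01.
Qed.

Let cylinderE (w w' : nat -> X) n :
  cylinder w n w' <-> mkseq w' n = mkseq w n.
Proof.
split => [h|h t tn].
  by apply/eq_in_map => t; rewrite mem_iota add0n => /h.
by have := congr1 (nth point ^~ t) h; rewrite !nth_mkseq.
Qed.

Let coding_cylinder (w : nat -> X) n :
  coding @^-1` cylinder w n `&` `[0, 1[ =
  [set u | mem (rev (mkseq w n)) u] `&` `[0, 1[.
Proof.
apply/seteqP; split => u /= [h u01]; split=> //; move: u01; rewrite in_itv/=;
  move=> u01; have := @wordP u (rev (mkseq w n)) u01;
  rewrite size_rev size_mkseq word_coding// => -[h1 h2].
  by apply: h1; congr rev; apply/cylinderE.
by apply/cylinderE; apply: (can_inj revK); exact: h2.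
Qed.

Let mem01 r u : mem r u -> 0 <= u < 1.
Proof.
elim: r => [|x r IH]; first by rewrite /mem/= add0r.
by move=> /mem_tail.
Qed.

Let memE r : [set u | mem r u] `&` `[0, 1[ = `[lo r, lo r + q r[%classic.
Proof.
apply/seteqP; split => u /=; rewrite !in_itv/=; first by case.
by move=> h; split => //; exact: mem01 h.
Qed.

Let measurable_coding : measurable_fun [set: R] coding.
Proof.
apply: (@measurability _ _ _ (traj X) setT coding (@cylinders X)) => //.
move=> _ [_ [w [n ->]] <-]; rewrite setTI.
rewrite -(setUIDK (coding @^-1` cylinder w n) `[0, 1[); apply: measurableU.
  by rewrite coding_cylinder memE; exact: measurable_itv.
have [h|h] := pselect (cylinder w n (fun=> point)).
  rewrite (_ : _ `\` _ = ~` `[0, 1[).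
    by apply: measurableC; exact: measurable_itv.
  apply/seteqP; split => u /=; first by case.
  by move=> u01; split => //; rewrite in_itv/= in u01; move/negP/negbTE : u01;
    rewrite /coding => ->.
rewrite (_ : _ `\` _ = set0); first exact: measurable0.
apply/seteqP; split => u //= [+ u01]; rewrite in_itv/= in u01.
by move/negP/negbTE : u01; rewrite /coding => ->.
Qed.

Let m01 : measurable (`[0, 1[%classic : set R).
Proof. exact: measurable_itv. Qed.

Let P0 := mrestr (@lebesgue_measure R) m01.

Definition coding_law := pushforward P0 coding : set (traj X) -> \bar R.

Let coding_law0 : coding_law set0 = 0%E.
Proof.
by rewrite /coding_law /pushforward preimage_set0 /P0 /mrestr set0I measure0.
Qed.

Let coding_law_ge0 A : (0 <= coding_law A)%E.
Proof. exact: measure_ge0. Qed.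

Let coding_law_sigma_additive : semi_sigma_additive coding_law.
Proof. exact: measure_semi_sigma_additive. Qed.

HB.instance Definition _ := isMeasure.Build _ _ _ coding_law
  coding_law0 coding_law_ge0 coding_law_sigma_additive.

Let coding_lawT : coding_law setT = 1%E.
Proof.
rewrite /coding_law /pushforward preimage_setT /P0 /mrestr setTI.
by rewrite lebesgue_measure_itv/= lte_fin ltr01 oppr0 adde0.
Qed.

HB.instance Definition _ := Measure_isProbability.Build _ _ _ coding_law
  coding_lawT.

Lemma process_law_exists : exists mu : probability (traj X) R,
  forall w n, mu (cylinder w n) = (\prod_(t < n) c (mkseq w t) (w t))%:E.
Proof.
exists coding_law => w n.
transitivity (@lebesgue_measure R (coding @^-1` cylinder w n `&` `[0, 1[)).
  by [].
rewrite coding_cylinder memE lebesgue_measure_itv/= lte_fin ltrDl.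
have -> : \prod_(t < n) c (mkseq w t) (w t) = q (rev (mkseq w n)).
  elim: n => [|n IH]; first by rewrite big_ord0.
  by rewrite big_ord_recr rev_mkseq /= revK IH.
have := q_ge0 (rev (mkseq w n)); rewrite le_eqVlt => /orP[/eqP <-|->].
  by rewrite ltxx.
by rewrite -EFinB addrAC subrr add0r.
Qed.

Definition process_law : probability (traj X) R :=
  sval (cid process_law_exists).

Lemma process_lawE w n :
  process_law (cylinder w n) = (\prod_(t < n) c (mkseq w t) (w t))%:E.
Proof. exact: (svalP (cid process_law_exists)). Qed.

Lemma process_law_unique (mu : probability (traj X) R) :
  (forall w n, mu (cylinder w n) = (\prod_(t < n) c (mkseq w t) (w t))%:E) ->
  forall A, measurable A -> mu A = process_law A.
Proof.
move=> muE A mA.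
pose G : set (set (traj X)) := @cylinders X `|` [set set0].
have GE : @measurable _ (traj X) = <<s G >>.
  apply/seteqP; split => B mB.
    by apply: sub_sigma_algebra2 mB => C; left.
  move: B mB; apply: smallest_sub; first exact: sigma_algebra_measurable.
  by move=> C [[w [n ->]]|->]; [exact: measurable_cylinder|exact: measurable0].
have Icyl (w w' : nat -> X) n m : (n <= m)%N ->
    G (cylinder w n `&` cylinder w' m).
  move=> nm; have [h|h] := pselect (cylinder w n w').
    left; exists w', m; apply/seteqP; split => v /=; first by case.
    move=> hv; split => // t tn; rewrite hv ?h//; exact: leq_trans nm.
  right; apply/seteqP; split => v //= [h1 h2]; apply: h => t tn.
  by rewrite -h2 ?h1//; exact: leq_trans nm.
apply: (@measure_unique _ _ _ G (fun=> setT)) => //.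
- move=> B C [[w [n ->]]|->] [[w' [m ->]]|->];
    rewrite ?set0I ?setI0; [|by right..].
  by have [mn|/ltnW nm] := leqP m n; [rewrite setIC|]; exact: Icyl.
- by move=> _; left; exists (fun=> point), 0; apply/seteqP; split.
- by rewrite bigcup_const.
- by move=> B [[w [n ->]]|->];
    [exact: etrans (muE w n) (esym (process_lawE w n))|by rewrite !measure0].
- by move=> _; exact: le_lt_trans (probability_le1 mu measurableT) (ltry 1).
Qed.

End process_law.

Section robust_mdp.
Context (R : realType) (S A : finPointedType).

Definition transitions := S -> A -> fdist R S.

Record rmdp := RMDP {
  reward : S -> A -> S -> R;
  uncertainty : set transitions;
  initial : fdist R S;
  uncertainty_nonempty : uncertainty !=set0;
  uncertainty_compact :
    compact ((fun P : transitions => fun x => P x.1.1 x.1.2 x.2) @` uncertainty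
             : set {ptws S * A * S -> R}) }.

Definition sa_rectangular (M : rmdp) :=
  exists V : S -> A -> set (fdist R S),
    uncertainty M = [set P | forall s a, V s a (P s a)].

(* [pi [:: (s_0, a_0); ...; (s_(t-1), a_(t-1))] s_t] is the distribution of
   the action a_t *)
Definition policy := seq (S * A) -> S -> fdist R A.

Definition stationary_deterministic (sigma : S -> A) : policy :=
  fun _ s => fdirac R (sigma s).

Variable M : rmdp.
Implicit Types (pi : policy) (P : transitions) (gamma : R).

Definition next_state P (h : seq (S * A)) : fdist R S :=
  if h is sa :: h' then P (last sa h').1 (last sa h').2 else initial M.

Definition rmdp_law pi P : probability (traj (S * A)%type) R :=
  process_law (fun h => fpair (next_state P h) (pi h)).

Definition reward_at (w : nat -> S * A) (t : nat) : R :=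
  reward M (w t).1 (w t).2 (w t.+1).1.

Definition discounted_return gamma pi P : \bar R :=
  'E_(rmdp_law pi P)[fun w =>
    limn (series (fun t => gamma ^+ t * reward_at w t))].

Definition average_return pi P : \bar R :=
  (\int[rmdp_law pi P]_w
    limn_esup (fun T => (T.+1%:R^-1 * \sum_(t < T.+1) reward_at w t)%:E))%E.

(* [ereal_inf] also renders the minimum over the uncertainty set in the
   discounted case, for 0 <= gamma < 1: the return is then continuous in the
   transition probabilities, so that its infimum over a nonempty compact set
   is attained. *)
Definition worst_case (ret : policy -> transitions -> \bar R) pi : \bar R :=
  ereal_inf [set ret pi P | P in uncertainty M].

Definition robust_optimal (ret : policy -> transitions -> \bar R) pi :=
  worst_case ret pi = ereal_sup (range (worst_case ret)).

Definition discount_optimal gamma := robust_optimal (discounted_return gamma).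

Definition average_optimal := robust_optimal average_return.

End robust_mdp.

(* Main.v *)
(** Write [l] for one minus the discount factor. For a fixed stationary
    deterministic policy [sigma], let [w s] be the infimum of the gains from
    [s] of the stationary chains that the adversary can choose. The point is
    that [l] times the discounted return is, for [l] small, at least [w - e]
    uniformly over the uncertainty set. Let [V] be this normalized discounted
    value for some [P], and [s] a state where [w - V] is maximal. As [w] is
    subharmonic for [P], the value [V] does not decrease in mean along any
    number of steps from [s], so the discounted mean of the first [n] rewards
    is at most [V s]; by compactness finitely many [n] suffice for the mean of
    the first [n] rewards to be close to the gain, which is at least [w s].
    Hence the worst cases of the finitely many policies [sigma] are ordered
    near [l = 0] as the numbers [G sigma], the initial means of [w].

    It remains to bound the worst case of an arbitrary policy by the largest
    [G sigma]. Give the adversary one near-optimal answer to each [sigma]. In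
    the game where it may only mix these answers state-action-wise, which
    rectangularity allows, pure stationary strategies that are optimal for
    arbitrarily small [l] form a saddle point for the gain; a martingale
    argument shows that history-dependent policies gain nothing against the
    resulting fixed transition probabilities. *)

From HB Require Import structures.
Require Import Defs.
From mathcomp Require Import all_boot all_order all_algebra.
From mathcomp Require Import all_classical all_reals all_analysis.
From mathcomp Require Import measurable_realfun.
From mathcomp Require Import ring lra zify.

Set Implicit Arguments.
Unset Strict Implicit.
Unset Printing Implicit Defensive.

Import Order.TTheory GRing.Theory Num.Theory.
Import numFieldNormedType.Exports.

Local Open Scope classical_set_scope.
Local Open Scope ring_scope.

(** * Means over finite distributions *)

Section mean.
Context (R : realType) (T : finType).
Implicit Types (d : fdist R T) (f g : T -> R) (k : R).

Definition mean d f : R := \sum_x d x * f x.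

Lemma eq_mean d f g : f =1 g -> mean d f = mean d g.
Proof. by move=> fg; apply: eq_bigr => x _; rewrite fg. Qed.

Lemma meanD d f g : mean d (fun x => f x + g x) = mean d f + mean d g.
Proof. by rewrite /mean -big_split; apply: eq_bigr => x _; rewrite mulrDr. Qed.

Lemma meanZ d k f : mean d (fun x => k * f x) = k * mean d f.
Proof. by rewrite /mean mulr_sumr; apply: eq_bigr => x _; rewrite mulrCA. Qed.

Lemma meanN d f : mean d (fun x => - f x) = - mean d f.
Proof. by rewrite /mean -sumrN; apply: eq_bigr => x _; rewrite mulrN. Qed.

Lemma meanB d f g : mean d (fun x => f x - g x) = mean d f - mean d g.
Proof. by rewrite meanD meanN. Qed.

Lemma mean_cst d k : mean d (fun=> k) = k.
Proof. by rewrite /mean -mulr_suml fpmf_sum1 mul1r. Qed.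

Lemma le_mean d f g : (forall x, f x <= g x) -> mean d f <= mean d g.
Proof. by move=> fg; apply: ler_sum => x _; rewrite ler_wpM2l ?fpmf_ge0. Qed.

Lemma mean_le d f k : (forall x, f x <= k) -> mean d f <= k.
Proof. by move=> fk; rewrite -(mean_cst d k); exact: le_mean. Qed.

Lemma mean_ge d f k : (forall x, k <= f x) -> k <= mean d f.
Proof. by move=> fk; rewrite -(mean_cst d k); exact: le_mean. Qed.

Lemma mean_dirac y f : mean (fdirac R y) f = f y.
Proof.
rewrite /mean (bigD1 y)//= eqxx mul1r big1 ?addr0// => x /negbTE ->.
by rewrite mul0r.
Qed.

Lemma normr_mean_le d f k : (forall x, `|f x| <= k) -> `|mean d f| <= k.
Proof.
move=> fk; rewrite ler_norml; apply/andP; split.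
  by apply: mean_ge => x; have := fk x; rewrite ler_norml => /andP[].
by apply: mean_le => x; have := fk x; rewrite ler_norml => /andP[].
Qed.

Lemma fin_bound f : exists2 C : R, 0 <= C & forall x, `|f x| <= C.
Proof.
exists (\sum_x `|f x|); first by apply: sumr_ge0.
move=> x; rewrite (bigD1 x)//= lerDl; exact: sumr_ge0.
Qed.

End mean.

Lemma mean_pair (R : realType) (T U : finType) (d : fdist R T)
    (k : T -> fdist R U) (f : T * U -> R) :
  mean (fpair d k) f = mean d (fun x => mean (k x) (fun y => f (x, y))).
Proof.
rewrite /mean.
transitivity (\sum_x \sum_y d x * k x y * f (x, y)).
  by rewrite pair_bigA; apply: eq_bigr => -[x y].
apply: eq_bigr => x _; rewrite mulr_sumr; apply: eq_bigr => y _.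
by rewrite mulrA.
Qed.

(** Knaster-Tarski: the pointwise supremum of the functions [u] below [B] with [u <= F u] is a fixed
    point. It provides the values of discounted chains and of discounted games. *)
Lemma monotone_fixpoint (R : realType) (T : Type) (F : (T -> R) -> T -> R)
    (B : R) :
  (forall u v, (forall s, u s <= v s) -> forall s, F u s <= F v s) ->
  0 <= B -> (forall s, F (fun=> B) s <= B) ->
  (forall s, - B <= F (fun=> - B) s) ->
  exists v, forall s, v s = F v s.
Proof.
move=> Fmono B0 FB FNB.
pose post (u : T -> R) := forall s, u s <= B /\ u s <= F u s.
pose E s := [set u s | u in post].
have postNB : post (fun=> - B) by move=> s; split=> //; lra.
have Esup s : has_sup (E s).
  split; first by exists (- B), (fun=> - B).
  by exists B => _ [u pu <-]; case: (pu s).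
pose v s := sup (E s).
have postv u s : post u -> u s <= v s.
  by move=> pu; apply: sup_upper_bound => //; exists u.
have vF s : v s <= F v s.
  apply: ge_sup; first by case: (Esup s).
  move=> _ [u pu <-]; apply: le_trans (pu s).2 _.
  by apply: Fmono => s'; exact: postv.
have vB s : v s <= B.
  apply: ge_sup; first by case: (Esup s).
  by move=> _ [u pu <-]; case: (pu s).
exists v => s; apply/eqP; rewrite eq_le vF /=.
apply: (@postv (F v)) => s'; split; last exact: Fmono.
by apply: le_trans (FB s'); apply: Fmono.
Qed.

(** * Discounted values and gains of a finite Markov chain *)

Section chain.
Context (R : realType) (T : finType).
Implicit Types (Q : T -> fdist R T) (rho g h V u e : T -> R) (l c : R).

(** The weight [l] on the reward normalizes [V], which for [l] in ]0, 1] is then bounded by the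
    rewards, and which tends to the gain as [l] tends to 0. *)
Definition discounted_value l Q rho V :=
  forall s, V s = l * rho s + (1 - l) * mean (Q s) V.

(** The evaluation equations of a multichain average-reward problem: [g] is harmonic, possibly not
    constant, and [h] solves a Poisson equation. *)
Definition gain_bias Q rho g h :=
  forall s, g s = mean (Q s) g /\ g s + h s = rho s + mean (Q s) h.

(** At a maximizer of [e] the mean of [e] is at most [e] itself, which leaves [l * e <= l * c]. *)
Lemma discounted_max_principle Q l c e : 0 < l -> l <= 1 ->
  (forall s, e s <= (1 - l) * mean (Q s) e + l * c) -> forall s, e s <= c.
Proof.
move=> l0 l1 he s.
have [t _ tmax] := @arg_maxP _ _ _ s xpredT e isT.
apply: le_trans (tmax s isT) _.
have m : mean (Q t) e <= e t by apply: mean_le => x; exact: tmax.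
have := he t.
have : (1 - l) * mean (Q t) e <= (1 - l) * e t by rewrite ler_wpM2l// subr_ge0.
move=> h1 h2; rewrite -(ler_pM2l l0); lra.
Qed.

Lemma discounted_value_ex Q l rho : 0 < l -> l <= 1 ->
  exists V, discounted_value l Q rho V.
Proof.
move=> l0 l1; have [B B0 hB] := fin_bound rho.
have hB' s : - B <= rho s <= B by rewrite -ler_norml.
have [|||v hv] := @monotone_fixpoint R T
  (fun V s => l * rho s + (1 - l) * mean (Q s) V) B _ B0; last by exists v.
- move=> u v uv s; rewrite lerD2l ler_wpM2l ?subr_ge0//; exact: le_mean.
- move=> s; rewrite mean_cst; have /andP[_ /(ler_wpM2l (ltW l0))] := hB' s; lra.
- move=> s; rewrite mean_cst.
  have /andP[/(ler_wpM2l (ltW l0)) + _] := hB' s; lra.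
Qed.

(** Passage to the limit along arbitrarily small [l], the form in which saddle points will be
    available. *)
Lemma le_eps_small (x y C : R) :
  (forall d, 0 < d -> exists l, [/\ 0 < l, l < d & x <= y + l * C]) -> x <= y.
Proof.
move=> H; apply/ler_addgt0Pr => e e0.
have C0 : 0 < `|C| + 1 by rewrite ltr_wpDl.
have [l [l0 ld xy]] := H (e / (`|C| + 1)) (divr_gt0 e0 C0).
apply: le_trans xy _; rewrite lerD2l.
move: ld; rewrite ltr_pdivlMr// => ld.
have /(ler_wpM2l (ltW l0)) := ler_norm C; lra.
Qed.

(* [x] is invariant and [x = y - Q y]; hence [n x = y - Q^n y] is bounded. The
   discounted maximum principle replaces the iteration. *)
Lemma invariant_coboundary_le0 Q (x y : T -> R) :
  (forall s, x s = mean (Q s) x) -> (forall s, x s = y s - mean (Q s) y) ->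
  forall s, x s <= 0.
Proof.
move=> hx hy s; have [Y Y0 hY] := fin_bound y.
apply: (@le_eps_small _ _ (2 * Y)) => d d0.
pose l := d / 2; have l0 : 0 < l by rewrite /l; lra.
exists l; split=> //; first by rewrite /l; lra.
(* For this [k] the terms in [x] cancel: [x - l * y] minus [1 - k] times its mean is
   [- k * l * y]. *)
pose k := l / (1 + l).
have k1 : 1 - k = (1 + l)^-1 by rewrite /k; field; apply/eqP; lra.
have k0 : 0 < k by rewrite divr_gt0//; lra.
have kl1 : k <= 1 by rewrite ler_pdivrMr; lra.
have := @discounted_max_principle Q k (l * Y) (fun s => x s - l * y s) k0 kl1.
move=> /(_ _ s) H.
have {H} : x s - l * y s <= l * Y.
  apply: H => t; rewrite meanB meanZ -hx k1.
  have -> : mean (Q t) y = y t - x t by rewrite [x t]hy; lra.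
  have l10 : 0 < 1 + l by lra.
  rewrite /k [leRHS](_ : _ = (x t - l * (y t - x t) + l * (l * Y)) / (1 + l)).
    rewrite ler_pdivlMr//.
    have : - Y <= y t <= Y by rewrite -ler_norml.
    move=> /andP[h1 h2].
    have : 0 <= l * l by rewrite mulr_ge0// ltW.
    nra.
  by field; apply/eqP; lra.
have : - Y <= y s <= Y by rewrite -ler_norml.
move=> /andP[h1 h2]; nra.
Qed.

(** The kernel and the image of [F], the identity minus [Q], meet only in 0 by
    [invariant_coboundary_le0] applied to [x] and [- x]. By rank-nullity they span the space, and
    [g] and [F h] are the components of [rho]. *)
Lemma gain_bias_ex Q rho : exists g h, gain_bias Q rho g h.
Proof.
pose F (u : {ffun T -> R^o}) : {ffun T -> R^o} :=
  [ffun s => u s - mean (Q s) u].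
have Flin : linear F.
  move=> a u v; apply/ffunP => s; rewrite !ffunE.
  rewrite (@eq_mean _ _ _ _ (fun x => a * u x + v x)); last first.
    by move=> x; rewrite !ffunE.
  by rewrite meanD meanZ /= /GRing.scale/=; ring.
pose FL := GRing.isLinear.Build _ _ _ _ F Flin.
pose Flinear : {linear {ffun T -> R^o} -> {ffun T -> R^o}} :=
  HB.pack F FL.
pose f := linfun Flinear.
have fE (w : {ffun T -> R^o}) : f w = F w by rewrite lfunE.
have cap0 : (lker f :&: limg f = 0)%VS.
  apply/eqP; rewrite -subv0; apply/subvP => x.
  rewrite memv_cap memv_ker fE => /andP[/eqP Fx0 /memv_imgP[y _ xy]].
  rewrite fE in xy; rewrite memv0; apply/eqP/ffunP => s; rewrite [RHS]ffunE.
  have hx t : x t = mean (Q t) x.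
    have /ffunP/(_ t) := Fx0; rewrite !ffunE => /eqP.
    by rewrite subr_eq0 => /eqP.
  have hy t : x t = y t - mean (Q t) y by rewrite {1}xy ffunE.
  apply/eqP; rewrite eq_le; apply/andP; split.
    exact: (invariant_coboundary_le0 hx hy).
  rewrite -oppr_le0.
  apply: (@invariant_coboundary_le0 Q (fun t => - x t) (fun t => - y t)) => t.
    by rewrite meanN -hx.
  by rewrite meanN hy; lra.
have sumT : (lker f + limg f)%VS = fullv.
  apply/eqP; rewrite eqEdim subvf/= dimv_disjoint_sum//.
  by rewrite -(limg_ker_dim f fullv) capfv.
pose r : {ffun T -> R^o} := [ffun s => rho s].
have : r \in (lker f + limg f)%VS by rewrite sumT memvf.
move=> /memv_addP[g gker [k /memv_imgP[h _ kE] rE]].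
rewrite fE in kE.
exists (g : T -> R), (h : T -> R) => s.
have := gker; rewrite memv_ker fE => /eqP/ffunP/(_ s); rewrite !ffunE => /eqP.
rewrite subr_eq0 => /eqP hg; split=> //.
have /ffunP/(_ s) := rE; rewrite kE !ffunE => ->; rewrite addrA.
by rewrite subrK.
Qed.

(** The function [V - g - l * h] solves the discounted equation with a source of order [l * l], so
    the maximum principle bounds it by [l * C]; the term [l * h] costs another [l * C]. *)
Lemma abel_estimate Q rho g h V l C : 0 < l -> l <= 1 ->
  gain_bias Q rho g h -> (forall s, `|h s| <= C) ->
  discounted_value l Q rho V -> forall s, `|V s - g s| <= l * (2 * C).
Proof.
move=> l0 l1 gh hC VE s.
pose e s := V s - g s - l * h s.
have eE t : e t = (1 - l) * mean (Q t) e - l * l * mean (Q t) h.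
  rewrite /e !meanB meanZ -(gh t).1 {1}VE.
  have -> : rho t = g t + h t - mean (Q t) h by rewrite (gh t).2; lra.
  by ring.
have Qh t : - C <= mean (Q t) h <= C.
  by rewrite -ler_norml; exact: normr_mean_le.
have ll : 0 <= l * l by rewrite mulr_ge0// ltW.
have e1 : e s <= l * C.
  apply: (@discounted_max_principle Q l) => // t; rewrite {1}eE.
  have /andP[] := Qh t; nra.
have e2 : - e s <= l * C.
  apply: (@discounted_max_principle Q l _ (fun s => - e s)) => // t.
  rewrite {1}eE meanN; have /andP[] := Qh t; nra.
have : - C <= h s <= C by rewrite -ler_norml.
move=> /andP[h1 h2]; rewrite ler_norml; apply/andP.
by split; move: e1 e2; rewrite /e; nra.
Qed.

Definition transport Q u : T -> R := fun s => mean (Q s) u.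

Lemma iter_transport_le Q u v n : (forall s, u s <= v s) ->
  forall s, iter n (transport Q) u s <= iter n (transport Q) v s.
Proof. by move=> uv; elim: n => [|n IH] s //=; exact: le_mean. Qed.

Lemma iter_transport_bound Q u n C : (forall s, `|u s| <= C) ->
  forall s, `|iter n (transport Q) u s| <= C.
Proof. by move=> uv; elim: n => [|n IH] s //=; exact: normr_mean_le. Qed.

Lemma iter_transportB Q u v n s :
  iter n (transport Q) (fun s => u s - v s) s =
  iter n (transport Q) u s - iter n (transport Q) v s.
Proof.
elim: n s => [//|n IH] s /=; rewrite -meanB /transport; exact: eq_mean.
Qed.

Lemma iter_transport_cst Q k n s : iter n (transport Q) (fun=> k) s = k.
Proof.
by elim: n s => [//|n IH] s /=; rewrite /transport (eq_mean _ IH) mean_cst.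
Qed.

Lemma iter_transport_subharmonic Q u n :
  (forall s, u s <= mean (Q s) u) -> forall s, u s <= iter n (transport Q) u s.
Proof.
move=> hu; elim: n => [//|n IH] s /=; apply: le_trans (hu s) _; exact: le_mean.
Qed.

(** As [g] is invariant and [rho] is [g] minus the increment of [h] under [Q], the sum
    telescopes. *)
Lemma cesaro_gain Q rho g h n : gain_bias Q rho g h -> forall s,
  \sum_(t < n) iter t (transport Q) rho s =
  n%:R * g s + h s - iter n (transport Q) h s.
Proof.
move=> gh; elim: n => [|n IH] s; first by rewrite big_ord0 mul0r add0r subrr.
rewrite big_ord_recr /= IH.
have gE m t : iter m (transport Q) g t = g t.
  by elim: m t => [//|m IHm] t /=; rewrite /transport (eq_mean _ IHm) -(gh t).1.
have rE : rho =1 fun s => g s - (mean (Q s) h - h s).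
  by move=> t; have := (gh t).2; lra.
have -> : iter n (transport Q) rho s =
    g s - (iter n.+1 (transport Q) h s - iter n (transport Q) h s).
  rewrite -(gE n s) iterSr -iter_transportB -iter_transportB.
  by congr (iter n _ _ _); apply/funext.
by rewrite /= -natr1; lra.
Qed.

Lemma discounted_value_iter l Q rho V n : discounted_value l Q rho V ->
  forall s, V s = l * (\sum_(t < n) (1 - l) ^+ t * iter t (transport Q) rho s) +
                  (1 - l) ^+ n * iter n (transport Q) V s.
Proof.
move=> VE; elim: n => [|n IH] s.
  by rewrite big_ord0 mulr0 add0r expr0 mul1r.
rewrite big_ord_recr /= {1}IH mulrDr -addrA; congr (_ + _).
have iE : iter n (transport Q) V s =
    l * iter n (transport Q) rho s + (1 - l) * iter n.+1 (transport Q) V s.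
  rewrite iterSr; elim: n s {IH} => [|n IH] s /=; first exact: VE.
  by rewrite {1}/transport (eq_mean _ IH) meanD !meanZ.
by rewrite iE /= exprS; ring.
Qed.

End chain.

(** * Finite games with perfect information *)

Section game.
Context (R : realType) (T A I : finType).
Variables (a0 : A) (i0 : I).
Variables (K : I -> T -> A -> fdist R T) (rho : I -> T -> A -> R).
Implicit Types (l : R) (u v : T -> R) (s : T) (a : A) (i : I).
Implicit Types (sigma : {ffun T -> A}) (iota : {ffun T * A -> I}).

Definition payoff l u s a i : R :=
  l * rho i s a + (1 - l) * mean (K i s a) u.

(** The minimizer sees the action before answering, which is why [iota] is indexed by state-action
    pairs. *)
Definition saddle l sigma iota v :=
  [/\ forall s, v s = payoff l v s (sigma s) (iota (s, sigma s)),
      forall s a, payoff l v s a (iota (s, a)) <= v s &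
      forall s i, v s <= payoff l v s (sigma s) i].

(** The Shapley operator is monotone, hence has a fixed point [v]; the minimizing answers and
    maximizing actions at [v] form the saddle. *)
Lemma saddle_ex l : 0 < l -> l <= 1 ->
  exists sigma iota v, saddle l sigma iota v.
Proof.
move=> l0 l1.
pose im u s a := [arg min_(i < i0) payoff l u s a i]%O.
pose mn u s a := payoff l u s a (im u s a).
pose am u s := [arg max_(a > a0) mn u s a]%O.
have imP u s a i : mn u s a <= payoff l u s a i.
  by rewrite /mn /im; case: arg_minP => // j _ /(_ i isT).
have amP u s a : mn u s a <= mn u s (am u s).
  by rewrite /am; case: arg_maxP => // b _ /(_ a isT).
have [B B0 hB] := fin_bound (fun x : I * T * A => rho x.1.1 x.1.2 x.2).
have hB' i s a : - B <= rho i s a <= B.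
  by rewrite -ler_norml; exact: (hB (i, s, a)).
have [|||v hv] := @monotone_fixpoint R T
  (fun v s => mn v s (am v s)) B _ B0.
- move=> u v uv s; apply: le_trans (amP v s (am u s)).
  apply: le_trans (imP u s (am u s) (im v s (am u s))) _.
  by rewrite lerD2l ler_wpM2l ?subr_ge0//; exact: le_mean.
- move=> s; rewrite /mn /payoff mean_cst.
  set i := im _ _ _; set a := am _ _.
  have /andP[_ /(ler_wpM2l (ltW l0))] := hB' i s a; lra.
- move=> s; rewrite /mn /payoff mean_cst.
  set i := im _ _ _; set a := am _ _.
  have /andP[/(ler_wpM2l (ltW l0)) + _] := hB' i s a; lra.
exists [ffun s => am v s], [ffun x => im v x.1 x.2], v; split.
- by move=> s; rewrite !ffunE.
- by move=> s a; rewrite ffunE /= [leRHS]hv; exact: amP.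
- by move=> s i; rewrite ffunE hv; exact: imP.
Qed.

(** Otherwise each [x] fails below some threshold [d x], and half the least of these thresholds,
    capped at 1, admits no [x] at all. *)
Lemma pigeonhole_small (X : finType) (P : X -> R -> Prop) :
  (forall l, 0 < l -> l <= 1 -> exists x, P x l) ->
  exists x, forall d, 0 < d -> exists l, [/\ 0 < l, l < d, l <= 1 & P x l].
Proof.
move=> HP; apply: contrapT => /forallNP nP.
have /choice[d hd] : forall x, exists d, 0 < d /\
    forall l, 0 < l -> l < d -> l <= 1 -> ~ P x l.
  move=> x; have /existsNP[d /not_implyP[d0 /forallNP H]] := nP x.
  by exists d; split=> // l l0 ld l1 Pxl; apply: (H l).
pose m := \big[Order.min/1]_x d x.
have m0 : 0 < m.
  by rewrite /m; elim/big_ind : _ => // [x y x0 y0|x _];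
    [rewrite lt_min x0|exact: (hd x).1].
have mle x : m <= d x by rewrite /m (bigD1 x)//= ge_min lexx.
have m1 : m <= 1.
  by rewrite /m; elim/big_rec: _ => // x y _ y1; rewrite ge_min y1 orbT.
have h0 : 0 < m / 2 by lra.
have h1 : m / 2 <= 1 by lra.
by have [x] := HP _ h0 h1; apply: (hd x).2 => //; have := mle x; lra.
Qed.

Definition selected_gain sigma iota g h := gain_bias
  (fun s => K (iota (s, sigma s)) s (sigma s))
  (fun s => rho (iota (s, sigma s)) s (sigma s)) g h.

(* A pair of strategies that is a saddle for arbitrarily small [l], found by
   the pigeonhole principle, is a saddle for the gains. The bias [h] against
   which all actions are compared is [v / l], with [v] the discounted value. *)
Lemma finite_game : exists sigma iota g,
  [/\ exists h, selected_gain sigma iota g h,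
      forall s a, mean (K (iota (s, a)) s a) g <= g s,
      forall s i, g s <= mean (K i s (sigma s)) g,
      forall i g' h', gain_bias (fun s => K i s (sigma s))
        (fun s => rho i s (sigma s)) g' h' -> forall s, g s <= g' s &
      forall e, 0 < e -> exists h, forall s a,
        rho (iota (s, a)) s a + mean (K (iota (s, a)) s a) h <=
        g s + e + h s].
Proof.
have [[sigma iota] /= hs] : exists x : {ffun T -> A} * {ffun T * A -> I},
    forall d, 0 < d -> exists l, [/\ 0 < l, l < d, l <= 1 &
      exists v, saddle l x.1 x.2 v].
  apply: pigeonhole_small => l l0 l1.
  by have [sg [io [v vP]]] := saddle_ex l0 l1; exists (sg, io), v.
have [g [h gh]] := gain_bias_ex
  (fun s => K (iota (s, sigma s)) s (sigma s))
  (fun s => rho (iota (s, sigma s)) s (sigma s)).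
have [C C0 hC] := fin_bound h.
(* [v] is the discounted value of the chain selected by [sigma] and [iota], whose gain is [g]. *)
have close l v : 0 < l -> l <= 1 -> saddle l sigma iota v ->
    forall s, v s - l * (2 * C) <= g s <= v s + l * (2 * C).
  move=> l0 l1 [vE _ _] s.
  have := @abel_estimate _ _ _ _ g h v l C l0 l1 gh hC vE s.
  by rewrite ler_norml => /andP[? ?]; apply/andP; split; lra.
have meanl d v l : (forall s, v s - l * (2 * C) <= g s <= v s + l * (2 * C)) ->
    mean d v - l * (2 * C) <= mean d g <= mean d v + l * (2 * C).
  move=> H; rewrite -[X in _ - X <= _](mean_cst d).
  rewrite -[X in _ <= _ + X](mean_cst d).
  rewrite -meanB -meanD; apply/andP; split; apply: le_mean => s;
    by have /andP[] := H s.
have [B B0 hB] := fin_bound (fun x : I * T * A => rho x.1.1 x.1.2 x.2).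
have hB' i s a : - B <= rho i s a <= B.
  by rewrite -ler_norml; exact: (hB (i, s, a)).
have [G G0 hG] := fin_bound g.
have hG' d : - G <= mean d g <= G by rewrite -ler_norml; exact: normr_mean_le.
(* As [l] vanishes, the saddle inequality loses its reward term. Exchanging [v] for [g] on both
   sides costs [4 * C], and the terms with a factor [l] cost [B + G]. *)
have gK s a : mean (K (iota (s, a)) s a) g <= g s.
  apply: (@le_eps_small _ _ _ (B + G + 4 * C)) => d d0.
  have [l [l0 ld l1 [v sv]]] := hs d d0; exists l; split=> //.
  have cl := close l v l0 l1 sv.
  have [_ /(_ s a) + _] := sv; rewrite /payoff.
  have /andP[] := meanl (K (iota (s, a)) s a) v l cl.
  have /andP[] := cl s; have /andP[] := hB' (iota (s, a)) s a.
  have /andP[] := hG' (K (iota (s, a)) s a).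
  have := mulr_ge0 (ltW l0) (ltW l0); nra.
exists sigma, iota, g; split.
- by exists h.
- exact: gK.
- move=> s i; apply: (@le_eps_small _ _ _ (B + G + 4 * C)) => d d0.
  have [l [l0 ld l1 [v sv]]] := hs d d0; exists l; split=> //.
  have cl := close l v l0 l1 sv.
  have [_ _ /(_ s i)] := sv; rewrite /payoff.
  have /andP[] := meanl (K i s (sigma s)) v l cl.
  have /andP[] := cl s; have /andP[] := hB' i s (sigma s).
  have /andP[] := hG' (K i s (sigma s)).
  have := mulr_ge0 (ltW l0) (ltW l0); nra.
- move=> i g' h' gh' s; have [C' C'0 hC'] := fin_bound h'.
  apply: (@le_eps_small _ _ _ (2 * C + 2 * C')) => d d0.
  have [l [l0 ld l1 [v sv]]] := hs d d0; exists l; split=> //.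
  have cl := close l v l0 l1 sv.
  have [V VE] := discounted_value_ex (fun s => K i s (sigma s))
    (fun s => rho i s (sigma s)) l0 l1.
  have := abel_estimate l0 l1 gh' hC' VE s.
  rewrite ler_norml => /andP[e1 e2].
  (* Against the constant answer [i], [v] is a subsolution of the equation of [V]; the gains are
     then compared by letting [l] vanish. *)
  have : v s - V s <= 0.
    apply: (@discounted_max_principle _ _ (fun s => K i s (sigma s)) l 0
      (fun s => v s - V s)) => // t.
    by rewrite meanB [V t]VE; have [_ _ /(_ t i)] := sv; rewrite /payoff; lra.
  by have /andP[] := cl s; lra.
- move=> e e0.
  have C1 : 0 < 4 * C + 1 by lra.
  have [l [l0 ld l1 [v sv]]] := hs _ (divr_gt0 e0 C1).
  rewrite ltr_pdivlMr// in ld.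
  exists (fun s => v s / l) => s a.
  have cl := close l v l0 l1 sv.
  have [_ /(_ s a) + _] := sv; rewrite /payoff => sva.
  have -> : mean (K (iota (s, a)) s a) (fun s => v s / l) =
      mean (K (iota (s, a)) s a) v / l.
    rewrite mulrC -meanZ; apply: eq_mean => t; exact: mulrC.
  have /andP[_ gv] := meanl (K (iota (s, a)) s a) v l cl.
  have /andP[vg _] := meanl (K (iota (s, a)) s a) v l cl.
  rewrite -subr_ge0.
  (* The first part is nonnegative by the saddle inequality; for the second, the mean of [v] is at
     most [g s + l * (2 * C)], and [l] was chosen with [l * (4 * C + 1) < e]. *)
  rewrite [leRHS](_ : _ = (v s - l * rho (iota (s, a)) s a -
    (1 - l) * mean (K (iota (s, a)) s a) v +
    l * (g s + e - mean (K (iota (s, a)) s a) v)) / l); last first.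
    by field; rewrite gt_eqF.
  rewrite divr_ge0 ?(ltW l0)// addr_ge0//; first by lra.
  by rewrite mulr_ge0 ?(ltW l0)//; have := gK s a; nra.
Qed.

End game.

(** * Laws of processes on finite horizons *)

Section finite_horizon.
Context (R : realType) (X : finPointedType).
Variable c : seq X -> fdist R X.
Implicit Types (n : nat) (F G : seq X -> R) (f : (nat -> X) -> R).

(** The recursion integrates the last letter first, so that one unfolding conditions on the past. *)
Fixpoint hexp n F : R :=
  if n is m.+1 then hexp m (fun h => mean (c h) (fun y => F (rcons h y)))
  else F [::].

Lemma le_hexp n F G : (forall h, size h = n -> F h <= G h) ->
  hexp n F <= hexp n G.
Proof.
elim: n F G => [|n IH] F G FG /=; first exact: FG.
by apply: IH => h hn; apply: le_mean => y; apply: FG; rewrite size_rcons hn.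
Qed.

Lemma eq_hexp n F G : (forall h, size h = n -> F h = G h) ->
  hexp n F = hexp n G.
Proof.
by move=> FG; apply/eqP; rewrite eq_le !le_hexp// => h hn; rewrite FG.
Qed.

Lemma hexpD n F G : hexp n (fun h => F h + G h) = hexp n F + hexp n G.
Proof.
elim: n F G => [//|n IH] F G /=; rewrite -IH; apply: eq_hexp => h _.
exact: meanD.
Qed.

Lemma hexpZ n k F : hexp n (fun h => k * F h) = k * hexp n F.
Proof.
elim: n F => [//|n IH] F /=; rewrite -IH; apply: eq_hexp => h _.
exact: meanZ.
Qed.

Lemma hexp_cst n k : hexp n (fun=> k) = k.
Proof.
elim: n => //= n IH; rewrite -[RHS]IH; apply: eq_hexp => h _.
exact: mean_cst.
Qed.

Lemma hexp_tuple n F : hexp n F =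
  \sum_(v : n.-tuple X) F v * \prod_(t < n) c (take t v) (nth point v t).
Proof.
elim: n F => [|n IH] F /=.
  rewrite (big_pred1 [tuple]) ?big_ord0 ?mulr1// => v.
  by rewrite [v]tuple0; apply/esym/eqP.
rewrite {}IH; pose rc (p : n.-tuple X * X) := [tuple of rcons p.1 p.2].
have rc_bij : bijective rc.
  apply: inj_card_bij; last by rewrite card_prod !card_tuple expnSr.
  move=> [v x] [v' x'] /(congr1 val)/= /rcons_inj[vv' ->].
  by congr pair; exact: val_inj.
rewrite [RHS](reindex rc) /=; last exact: onW_bij.
rewrite -(pair_bigA _ (fun (v : n.-tuple X) (y : X) => F (rcons v y) *
  \prod_(t < n.+1) c (take t (rcons v y)) (nth point (rcons v y) t)))/=.
apply: eq_bigr => v _; rewrite /mean mulr_suml; apply: eq_bigr => y _.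
rewrite big_ord_recr/= -cats1 take_size_cat ?size_tuple//.
rewrite nth_cat size_tuple ltnn subnn/=.
rewrite [in RHS](eq_bigr (fun t : 'I_n => c (take t v) (nth point v t))).
  by ring.
move=> t _; rewrite takel_cat ?size_tuple; last exact: ltnW.
by rewrite nth_cat size_tuple ltn_ord.
Qed.

Definition local n f :=
  forall w w', (forall t, (t < n)%N -> w t = w' t) -> f w = f w'.

Let tup n (w : nat -> X) : n.-tuple X := [tuple w i | i < n].

Let nth_tup n w t : (t < n)%N -> nth point (tup n w) t = w t.
Proof. by move=> tn; rewrite -(tnth_nth _ _ (Ordinal tn)) tnth_mktuple. Qed.

Let local_tup n f w : local n f -> f w = f (nth point (tup n w)).
Proof. by move=> fn; apply: fn => t tn; rewrite nth_tup. Qed.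

Let local_indic n f : local n f -> forall w, f w =
  \sum_(v : n.-tuple X) f (nth point v) * \1_(cylinder (nth point v) n) w.
Proof.
move=> fn w; rewrite (bigD1 (tup n w))//= big1 ?addr0.
  rewrite -local_tup// indicE mem_set ?mulr1// => t tn.
  by rewrite nth_tup.
move=> v vw; rewrite indicE memNset ?mulr0// => /= h; move/eqP: vw; apply.
apply: eq_from_tnth => i; rewrite tnth_mktuple (tnth_nth point) h//.
Qed.

Lemma local_bound n f : local n f ->
  exists2 C : R, 0 <= C & forall w, `|f w| <= C.
Proof.
move=> fn; have [C C0 hC] := fin_bound (fun v : n.-tuple X => f (nth point v)).
by exists C => // w; rewrite (local_tup w fn).
Qed.

Lemma local_measurable n f : local n f ->
  measurable_fun [set: traj X] (f : traj X -> R).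
Proof.
move=> /local_indic/funext ->; apply: measurable_sum => v.
apply: measurable_funM => //; apply: measurable_indic.
exact: measurable_cylinder.
Qed.

Lemma local_integrable n f : local n f ->
  (process_law c).-integrable [set: traj X] (EFin \o (f : traj X -> R)).
Proof.
move=> fn; apply: measurable_bounded_integrable => //.
- exact: le_lt_trans (probability_le1 _ measurableT) (ltry 1).
- exact: local_measurable fn.
- have [C C0 hC] := local_bound fn.
  exists C; split; first exact: num_real.
  by move=> k Ck w _; apply: le_trans (ltW Ck).
Qed.

(** By [local_indic], [f] is a finite combination of indicators of cylinders of length [n], and
    their masses are the products in [hexp_tuple]. *)
Lemma local_integral n f : local n f ->
  (\int[process_law c]_w (f w)%:E)%E =
  (hexp n (fun h => f (nth point h)))%:E.
Proof.
move=> fn.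
under eq_integral => w _ do rewrite (local_indic fn) -sumEFin.
rewrite (@integral_sum _ (traj X) R (process_law c) setT measurableT
  (n.-tuple X) (fun v w => (f (nth point v) *
    \1_(cylinder (nth point v) n) w)%:E)); last first.
  move=> v; apply: (@local_integrable n
    (fun w => f (nth point v) * \1_(cylinder (nth point v) n) w)).
  move=> w w' ww'; congr (_ * _).
  have wE :
      (w \in cylinder (nth point v) n) = (w' \in cylinder (nth point v) n).
    by apply/idP/idP; rewrite !inE => h t tn; rewrite -h ?ww'.
  by rewrite !indicE wE.
rewrite hexp_tuple -sumEFin; apply: eq_bigr => v _.
under eq_integral do rewrite EFinM.
rewrite integralZl//; last first.
  by apply: integrable_indic; exact: measurable_cylinder.
rewrite integral_indic//; last exact: measurable_cylinder.
rewrite setIT EFinM; congr (_ * _)%E.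
transitivity (process_law c (cylinder (nth point v) n)) => //.
rewrite process_lawE; congr EFin; apply: eq_bigr => t _; congr (c _ _).
rewrite -{2}(mkseq_nth point v) size_tuple /mkseq -map_take take_iota.
by congr (map _ (iota _ _)); apply/esym/minn_idPl/ltnW.
Qed.

End finite_horizon.

(** * Average and discounted returns *)

Section limsup.
Context d (T : measurableType d) (R : realType) (mu : probability T R).

Lemma limn_esup_le_near (u : (\bar R)^nat) (l : \bar R) :
  (\forall n \near \oo, u n <= l)%E -> (limn_esup u <= l)%E.
Proof.
move=> ul; rewrite /limn_esup limf_esupE.
apply: ge_ereal_inf; exists (ereal_sup (u @` [set n | u n <= l]%E)).
  by exists [set n | u n <= l]%E.
by apply: ge_ereal_sup => _ [n nl <-].
Qed.

Lemma abse_limn_esup_le (u : nat -> R) (B : R) : (forall n, `|u n| <= B) ->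
  (`|limn_esup (fun n => (u n)%:E)| <= B%:E)%E.
Proof.
move=> uB.
have absP (x : \bar R) : ((- B)%:E <= x -> x <= B%:E -> `|x| <= B%:E)%E.
  by case: x => [x||]; rewrite ?leNye ?leey// !lee_fin ler_norml => -> ->.
apply: absP.
  apply: le_trans (limn_einf_sup _); rewrite /limn_einf EFinN leeN2.
  apply: limn_esup_le_near; apply: nearW => n; rewrite -EFinN lee_fin.
  by apply: le_trans (uB n); rewrite -normrN ler_norm.
apply: limn_esup_le_near; apply: nearW => n; rewrite lee_fin.
exact: le_trans (ler_norm _) (uB n).
Qed.

Lemma bounded_fun_integrable (f : T -> R) (B : R) :
  measurable_fun setT f -> (forall w, `|f w| <= B) ->
  mu.-integrable setT (EFin \o f).
Proof.
move=> mf fB; apply: measurable_bounded_integrable => //.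
  exact: le_lt_trans (probability_le1 _ measurableT) (ltry 1).
exists B; split; first exact: num_real.
by move=> k Bk w _; apply: le_trans (ltW Bk).
Qed.

Lemma limn_esup_integrable (f : nat -> T -> R) (B : R) :
  (forall n, measurable_fun setT (f n)) -> (forall n w, `|f n w| <= B) ->
  mu.-integrable setT (fun w => limn_esup (fun n => (f n w)%:E)).
Proof.
move=> mf fB.
apply: (@le_integrable _ _ _ _ _ measurableT _ (EFin \o cst `|B|)).
- by apply: measurable_fun_limn_esup => n; exact/measurable_EFinP.
- move=> w _ /=; apply: (@le_trans _ _ B%:E).
    exact: (abse_limn_esup_le (fun n => fB n w)).
  by rewrite lee_fin normr_id ler_norm.
- exact: finite_measure_integrable_cst.
Qed.

(** The threshold on [n] depends on [w], so the limit superior is bounded path by path before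
    integrating. The partial sums are replaced by the whole tail [W] from [m], whose integral is at
    most [e] for a suitable [m] since the means [z] are summable. *)
Lemma integral_limn_esup_le (f G Z : nat -> T -> R) (z : nat -> R)
    (a B C e : R) :
  (forall n, measurable_fun setT (f n)) -> (forall n w, `|f n w| <= B) ->
  (forall m, measurable_fun setT (G m)) -> (forall m w, `|G m w| <= B) ->
  (forall m, \int[mu]_w (G m w)%:E <= a%:E)%E ->
  (forall t, measurable_fun setT (Z t)) -> (forall t w, 0 <= Z t w) ->
  (forall t, \int[mu]_w (Z t w)%:E = (z t)%:E)%E ->
  (forall n, \sum_(t < n) z t <= C) -> 0 < e ->
  (forall m w, \forall n \near \oo,
    f n w <= G m w + e + \sum_(m <= t < n.+2) Z t w) ->
  (\int[mu]_w limn_esup (fun n => (f n w)%:E) <= (a + 2 * e)%:E)%E.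
Proof.
move=> mf fB mG GB Ga mZ Z0 Zz zC e0 H.
have z0 t : 0 <= z t.
  rewrite -lee_fin -Zz; apply: integral_ge0 => w _; rewrite lee_fin; exact: Z0.
have zy : (\sum_(0 <= t <oo) (z t)%:E < +oo)%E.
  apply: (@le_lt_trans _ _ C%:E); last exact: ltry.
  apply: lime_le; first by apply: is_cvg_nneseries => t _ _; rewrite lee_fin.
  by apply: nearW => n; rewrite sumEFin lee_fin big_mkord.
have [m _ hm] : \forall m \near \oo, (\sum_(m <= t <oo) (z t)%:E <= e%:E)%E.
  have := @nneseries_tail_cvg R (fun t => (z t)%:E) xpredT zy
    (fun t _ => z0 t).
  move=> /fine_cvgP[fin] /cvgrPdist_le /(_ e e0) dist.
  near=> m.
  have f1 : (\sum_(m <= t <oo) (z t)%:E)%E \is a fin_num by near: m.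
  rewrite -(fineK f1) lee_fin.
  apply: le_trans (ler_norm _) _; rewrite -normrN -[X in `|X|]add0r.
  by near: m.
have {}hm := hm m (leqnn m).
pose W w := (\sum_(0 <= t <oo) (Z (t + m)%N w)%:E)%E.
have mW : measurable_fun setT W.
  apply: ge0_emeasurable_sum => [t w _ _|t _]; first by rewrite lee_fin.
  exact/measurable_EFinP.
have W0 w : (0 <= W w)%E by apply: nneseries_ge0 => t _ _; rewrite lee_fin.
have iW : (\int[mu]_w W w <= e%:E)%E.
  rewrite integral_nneseries//; last 2 first.
  - by move=> t; exact/measurable_EFinP.
  - by move=> t w _; rewrite lee_fin.
  under eq_eseriesr => t _ do rewrite Zz.
  by rewrite (@nneseries_addn _ (fun t => (z t)%:E)).
have WI : mu.-integrable setT W.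
  apply/integrableP; split=> //.
  apply: (@le_lt_trans _ _ e%:E); last exact: ltry.
  by under eq_integral => w _ do rewrite gee0_abs//.
have GI : mu.-integrable setT (EFin \o G m) by exact: bounded_fun_integrable.
have eI : mu.-integrable setT (EFin \o cst e).
  exact: finite_measure_integrable_cst.
pose F w := ((G m w)%:E + e%:E + W w)%E.
apply: (@le_trans _ _ (\int[mu]_w F w)%E).
  apply: le_integral => //.
  - exact: limn_esup_integrable fB.
  - by apply: integrableD => //; exact: integrableD.
  move=> w _; apply: limn_esup_le_near; near=> n.
  apply: (@le_trans _ _ (G m w + e + \sum_(m <= t < n.+2) Z t w)%:E).
    by rewrite lee_fin; near: n; exact: H.
  rewrite /F !EFinD leeD2l// /W.
  rewrite (@nneseries_addn _ (fun t => (Z t w)%:E)); last first.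
    by move=> t; rewrite lee_fin.
  rewrite -sumEFin; apply: nneseries_lim_ge => t _ _; exact: Z0.
have GeI := integrableD measurableT GI eI.
rewrite (integralD measurableT GeI WI) (integralD measurableT GI eI).
have e1 : (\int[mu]_w (EFin \o cst e) w <= e%:E)%E.
  have eT : (e%:E * mu setT = e%:E)%E by rewrite probability_setT mule1.
  rewrite le_eqVlt; apply/orP; left; apply/eqP.
  exact: etrans (integral_cst mu measurableT e%:E) eT.
apply: (@le_trans _ _ (a%:E + e%:E + e%:E)%E).
  by apply: leeD => //; apply: leeD => //; exact: Ga.
by rewrite -!EFinD lee_fin; lra.
Unshelve. all: by end_near. Qed.

End limsup.

(** * Moments of bounded centred increments *)

Section moments.
Context (R : realType) (T : finType) (d : fdist R T) (x : T -> R) (k : R).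
Hypothesis x0 : mean d x = 0.
Hypothesis xk : forall s, `|x s| <= k.

Let x2 s : (x s) ^+ 2 <= k ^+ 2.
Proof.
have := xk s; rewrite ler_norml => /andP[h1 h2]; nra.
Qed.

Lemma mean_sqr_le m : mean d (fun s => (m + x s) ^+ 2) <= m ^+ 2 + k ^+ 2.
Proof.
apply: (@le_trans _ _ (mean d (fun s => (m ^+ 2 + k ^+ 2) + (2 * m) * x s))).
  by apply: le_mean => s; have := x2 s; nra.
by rewrite meanD mean_cst meanZ x0; lra.
Qed.

(** In the expansion, the term linear in [x] has mean zero and the one in [m * x ^+ 3] is absorbed
    through [0 <= ((m - x) * x) ^+ 2]. *)
Lemma mean_exp4_le m : mean d (fun s => (m + x s) ^+ 4) <=
  m ^+ 4 + 8 * k ^+ 2 * m ^+ 2 + 3 * k ^+ 4.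
Proof.
set b := (X in _ <= X).
apply: (@le_trans _ _ (mean d (fun s => b + (4 * m ^+ 3) * x s))).
  apply: le_mean => s; rewrite /b.
  have h1 : (x s) ^+ 2 * (x s) ^+ 2 <= k ^+ 2 * k ^+ 2.
    by rewrite ler_pM ?sqr_ge0.
  have h2 : m ^+ 2 * (x s) ^+ 2 <= m ^+ 2 * k ^+ 2.
    by rewrite ler_wpM2l ?sqr_ge0.
  have h3 : 0 <= ((m - x s) * x s) ^+ 2 by exact: sqr_ge0.
  have e1 : (m + x s) ^+ 4 = m ^+ 4 + 4 * m ^+ 3 * x s +
    6 * (m ^+ 2 * (x s) ^+ 2) + 4 * (m * (x s) ^+ 3) +
    (x s) ^+ 2 * (x s) ^+ 2 by ring.
  have e2 : ((m - x s) * x s) ^+ 2 = m ^+ 2 * (x s) ^+ 2 -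
    2 * (m * (x s) ^+ 3) + (x s) ^+ 2 * (x s) ^+ 2 by ring.
  have e3 : k ^+ 4 = k ^+ 2 * k ^+ 2 by ring.
  have e4 : 8 * k ^+ 2 * m ^+ 2 = 8 * (m ^+ 2 * k ^+ 2) by ring.
  rewrite e1 e3 e4; rewrite e2 in h3.
  move: h1 h2 h3; set u := m ^+ 2 * (x s) ^+ 2; set v := m * (x s) ^+ 3.
  set y := (x s) ^+ 2 * _; set z := k ^+ 2 * _; lra.
by rewrite meanD mean_cst meanZ x0; lra.
Qed.

End moments.

Lemma sum_inv_sqr_le (R : realType) n :
  \sum_(t < n) (t%:R^-1 : R) ^+ 2 <= 2.
Proof.
case: n => [|n]; first by rewrite big_ord0.
(* The sharper bound makes the induction work; the term [t = 0] vanishes because the inverse of 0 is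
   0. *)
suff H : \sum_(t < n.+1) (t%:R^-1 : R) ^+ 2 <= 2 - n%:R^-1.
  by apply: le_trans H _; rewrite gerBl invr_ge0.
elim: n => [|[|n] IH]; first by rewrite big_ord1 invr0 expr0n /=; lra.
  rewrite big_ord_recl big_ord1 /= /bump /= invr0 expr0n /= !invr1 expr1n.
  lra.
rewrite big_ord_recr /=.
apply: (@le_trans _ _ (2 - n.+1%:R^-1 + (n.+2%:R^-1) ^+ 2)).
  by rewrite lerD2r.
have n0 : 0 < n.+1%:R :> R by [].
rewrite -subr_ge0 -[n.+2]addn1 natrD.
set a := n.+1%:R in n0 *.
have -> : 2 - (a + 1)^-1 - (2 - a^-1 + (a + 1)^-1 ^+ 2) =
    (a * (a + 1) ^+ 2)^-1.
  by field; apply/andP; split; apply/eqP; lra.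
by rewrite invr_ge0 mulr_ge0 ?sqr_ge0// ltW.
Qed.

(** * Expectations under a history-dependent policy *)

Section controlled_process.
Context (R : realType) (S A : finPointedType) (M : rmdp R S A).
Variables (pi : policy R S A) (P : transitions R S A).
Implicit Types (n t : nat) (u : S -> R) (f : (nat -> S * A) -> R).

Definition history_law (h : seq (S * A)) := fpair (next_state M P h) (pi h).

Definition pexp n f := hexp history_law n (fun h => f (nth point h)).

Lemma integral_pexp n f : local n f ->
  (\int[rmdp_law M pi P]_w (f w)%:E = (pexp n f)%:E)%E.
Proof. exact: local_integral. Qed.

Lemma next_state_rcons h x : next_state M P (rcons h x) = P x.1 x.2.
Proof. by case: h => //= y h; rewrite last_rcons. Qed.

Lemma le_pexp n f f' : (forall w, f w <= f' w) -> pexp n f <= pexp n f'.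
Proof. by move=> ff'; apply: le_hexp => h _. Qed.

Lemma pexpD n f f' : pexp n (fun w => f w + f' w) = pexp n f + pexp n f'.
Proof. exact: hexpD. Qed.

Lemma pexpZ n k f : pexp n (fun w => k * f w) = k * pexp n f.
Proof. exact: hexpZ. Qed.

Lemma pexp_cst n k : pexp n (fun=> k) = k.
Proof. exact: hexp_cst. Qed.

Lemma pexpB n f f' : pexp n (fun w => f w - f' w) = pexp n f - pexp n f'.
Proof.
rewrite -[X in _ - X]mul1r -mulNr -pexpZ -pexpD.
by apply: eq_hexp => h _; rewrite mulN1r.
Qed.

Lemma pexp_local n f : local n f -> pexp n.+1 f = pexp n f.
Proof.
move=> fn; rewrite /pexp /=; apply: eq_hexp => h hn.
rewrite -[RHS](mean_cst (history_law h)); apply: eq_mean => y.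
by apply: fn => t tn; rewrite nth_rcons hn tn.
Qed.

(** The Markov property: given the past up to time [n], the value [f w] is frozen and the next state
    has law [P], whatever the policy. *)
Lemma pexp_next n f (phi : R -> S * A -> S -> R) : local n.+1 f ->
  pexp n.+2 (fun w => phi (f w) (w n) (w n.+1).1) =
  pexp n.+1 (fun w => mean (P (w n).1 (w n).2) (phi (f w) (w n))).
Proof.
move=> fn; rewrite /pexp.
transitivity (hexp history_law n.+1 (fun h => mean (history_law h)
  (fun y => phi (f (nth point (rcons h y))) (nth point (rcons h y) n)
    (nth point (rcons h y) n.+1).1))) => //.
apply: eq_hexp => h hn; rewrite mean_pair.
have -> : next_state M P h = P (nth point h n).1 (nth point h n).2.
  case/lastP: h hn => [hn|h x]; [by have := hn|rewrite size_rcons => -[hn]].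
  by rewrite next_state_rcons nth_rcons hn ltnn eqxx.
apply: eq_mean => s; rewrite -[RHS](mean_cst (pi h s)); apply: eq_mean => a.
rewrite !nth_rcons hn ltnSn ltnn eqxx /=; congr (phi _ _ _).
by apply: fn => t tn; rewrite nth_rcons hn tn.
Qed.

Definition state_exp t u := pexp t.+1 (fun w => u (w t).1).

Lemma state_exp0 u : state_exp 0 u = mean (initial M) u.
Proof.
rewrite /state_exp /pexp /= mean_pair; apply: eq_mean => s /=.
exact: mean_cst.
Qed.

Lemma state_expS t u : state_exp t.+1 u =
  pexp t.+1 (fun w => mean (P (w t).1 (w t).2) u).
Proof. exact: (@pexp_next t (fun=> 0) (fun _ _ s => u s)). Qed.

Lemma state_exp_le t u : (forall s a, mean (P s a) u <= u s) ->
  state_exp t u <= mean (initial M) u.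
Proof.
move=> hu; elim: t => [|t IH]; first by rewrite state_exp0.
by apply: le_trans IH; rewrite state_expS; apply: le_pexp => w; exact: hu.
Qed.

Lemma reward_at_local t : local t.+2 (reward_at M ^~ t).
Proof. by move=> w w' ww'; rewrite /reward_at !ww'. Qed.

Lemma normr_state_exp_le t u k :
  (forall s, `|u s| <= k) -> `|state_exp t u| <= k.
Proof.
move=> uk; have uk' s : - k <= u s <= k by rewrite -ler_norml.
rewrite ler_norml; apply/andP; split.
  rewrite -(pexp_cst t.+1 (- k)); apply: le_pexp => w.
  by have /andP[] := uk' (w t).1.
rewrite -(pexp_cst t.+1 k); apply: le_pexp => w.
by have /andP[] := uk' (w t).1.
Qed.

Lemma avg_reward_local n :
  local n.+2 (fun w => n.+1%:R^-1 * \sum_(t < n.+1) reward_at M w t).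
Proof.
move=> w w' ww'; congr (_ * _); apply: eq_bigr => t _.
apply: (@reward_at_local t) => u ut; apply: ww'.
by rewrite (leq_trans ut)// ltnS.
Qed.

Lemma avg_reward_bound : exists2 B : R, 0 <= B &
  forall n (w : nat -> S * A),
    `|n.+1%:R^-1 * \sum_(t < n.+1) reward_at M w t| <= B.
Proof.
have [B B0 hB] := fin_bound (fun x : S * A * S => reward M x.1.1 x.1.2 x.2).
exists B => // n w; rewrite normrM ger0_norm ?invr_ge0// ler_pdivrMl//.
apply: le_trans (ler_norm_sum _ _ _) _.
rewrite mulr_natl -[n.+1 in leRHS]card_ord -sumr_const; apply: ler_sum => t _.
exact: (hB (w t, (w t.+1).1)).
Qed.

End controlled_process.

(** * Upper bound for the average return of an arbitrary policy *)

Section average_upper_bound.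
Context (R : realType) (S A : finPointedType) (M : rmdp R S A).
Variables (pi : policy R S A) (P : transitions R S A) (g h : S -> R).
Hypothesis g_super : forall s a, mean (P s a) g <= g s.
Hypothesis gh_super : forall s a,
  mean (P s a) (reward M s a) + mean (P s a) h <= g s + h s.

Let Ex := pexp M pi P.

(** The martingale increment: reward plus next bias, centred by its conditional mean. *)
Let xi (x : S * A) (s : S) : R := reward M x.1 x.2 s + h s -
  mean (P x.1 x.2) (fun s => reward M x.1 x.2 s + h s).

Let mart t (w : nat -> S * A) := \sum_(u < t) xi (w u) (w u.+1).1.

Let xi0 x : mean (P x.1 x.2) (xi x) = 0.
Proof. by rewrite meanB mean_cst subrr. Qed.

Let mart_local t : local t.+1 (mart t).
Proof.
move=> w w' ww'; apply: eq_bigr => u _; rewrite !ww'// ltnS//.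
exact: ltnW.
Qed.

Let martS t w : mart t.+1 w = mart t w + xi (w t) (w t.+1).1.
Proof. by rewrite /mart big_ord_recr. Qed.

(** Fourth moments of order [t ^ 2] make those of [mart t w / t] summable; second moments would only
    give order [1 / t]. *)
Let mart_moments : exists2 k, 0 <= k &
  forall t, Ex t.+1 (fun w => mart t w ^+ 4) <= 7 * k ^+ 4 * t%:R ^+ 2.
Proof.
have [k k0 hk] := fin_bound (fun y : S * A * S => xi y.1 y.2).
have xik x s : `|xi x s| <= k by exact: (hk (x, s)).
exists k => //.
have m2 t : Ex t.+1 (fun w => mart t w ^+ 2) <= t%:R * k ^+ 2.
  elim: t => [|t IH].
    rewrite mul0r -(pexp_cst M pi P 1 0); apply: le_pexp => w.
    by rewrite /mart big_ord0 expr0n.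
  apply: (@le_trans _ _ (Ex t.+1 (fun w => mart t w ^+ 2 + k ^+ 2))).
    rewrite (_ : Ex t.+2 _ = Ex t.+2 (fun w =>
      (mart t w + xi (w t) (w t.+1).1) ^+ 2)); last first.
      by apply: eq_hexp => w _; rewrite martS.
    rewrite /Ex (pexp_next M pi P (fun m x s => (m + xi x s) ^+ 2)
      (@mart_local t)).
    by apply: le_pexp => w; exact: mean_sqr_le.
  by have := IH; rewrite /Ex pexpD pexp_cst -natr1; lra.
elim=> [|t IH].
  rewrite expr0n mulr0 -(pexp_cst M pi P 1 0); apply: le_pexp => w.
  by rewrite /mart big_ord0 expr0n.
apply: (@le_trans _ _ (Ex t.+1 (fun w => mart t w ^+ 4 +
    8 * k ^+ 2 * mart t w ^+ 2 + 3 * k ^+ 4))).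
  rewrite (_ : Ex t.+2 _ = Ex t.+2 (fun w =>
    (mart t w + xi (w t) (w t.+1).1) ^+ 4)); last first.
    by apply: eq_hexp => w _; rewrite martS.
  rewrite /Ex (pexp_next M pi P (fun m x s => (m + xi x s) ^+ 4)
    (@mart_local t)).
  by apply: le_pexp => w; exact: mean_exp4_le.
rewrite /Ex pexpD pexp_cst pexpD pexpZ -natr1.
have := m2 t; rewrite /Ex => m2t.
have k2 : 0 <= 8 * k ^+ 2 by rewrite mulr_ge0 ?sqr_ge0.
have /(ler_wpM2l k2) := m2t; move: IH; rewrite /Ex.
have k4 : 0 <= k ^+ 4 by rewrite exprn_ge0.
have t0 : 0 <= t%:R :> R by [].
have e : 8 * k ^+ 2 * (t%:R * k ^+ 2) = 8 * k ^+ 4 * t%:R by ring.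
rewrite e; nra.
Qed.

Let jump t (w : nat -> S * A) := (g (w t.+1).1 - g (w t).1) ^+ 2.

(** The bounded potential [phi] decreases in mean by at least the mean squared jump: the excess is
    twice the product of [G - g] and of [g] minus its next mean, both nonnegative. *)
Let jump_sum : exists C, forall n, \sum_(t < n) Ex t.+2 (jump t) <= C.
Proof.
have [G G0 hG] := fin_bound g.
have hG' s : - G <= g s <= G by rewrite -ler_norml.
pose phi s := 2 * G * g s - g s ^+ 2.
have [C C0 hC] := fin_bound phi.
pose st t := state_exp M pi P t phi.
have step t : Ex t.+2 (jump t) <= st t - st t.+1.
  rewrite /Ex (pexp_next M pi P (f := fun=> 0) (n := t)
    (fun _ x s => (g s - g x.1) ^+ 2))// /st state_expS -pexpB.
  apply: le_pexp => w; set x := w t.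
  rewrite (@eq_mean _ _ _ (fun s => (g s - g x.1) ^+ 2)
    (fun s => (g s ^+ 2 + g x.1 ^+ 2) + (- 2 * g x.1) * g s)); last first.
    by move=> s; ring.
  rewrite meanD meanD mean_cst meanZ meanB meanZ /phi.
  have := g_super x.1 x.2; have /andP[] := hG' x.1.
  set m := mean _ g; set q := mean _ _; nra.
exists (2 * C) => n; apply: (@le_trans _ _ (st 0%N - st n)).
  elim: n => [|n IH]; first by rewrite big_ord0 subrr.
  by rewrite big_ord_recr/=; have := step n; lra.
have := normr_state_exp_le M pi P 0 hC; have := normr_state_exp_le M pi P n hC.
by rewrite !ler_norml => /andP[? ?] /andP[? ?]; rewrite /st; lra.
Qed.

(** The state space is finite, so the nonzero jumps of [g] are bounded away from 0. *)
Let jump_scale : exists2 k, 0 <= k & forall s s', g s' - g s <=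
  k * (g s' - g s) ^+ 2.
Proof.
pose v (x : S * S) := `|g x.2 - g x.1|^-1.
exists (\sum_x v x); first by apply: sumr_ge0 => x _; rewrite invr_ge0.
move=> s s'; have [gg|gg] := eqVneq (g s' - g s) 0.
  by rewrite gg expr0n mulr0.
apply: (@le_trans _ _ (v (s, s') * (g s' - g s) ^+ 2)).
  rewrite /v /= -[(g s' - g s) ^+ 2]real_normK ?num_real// expr2 mulrA.
  by rewrite mulVf ?normr_eq0// mul1r ler_norm.
rewrite ler_wpM2r ?sqr_ge0// (bigD1 (s, s'))//= lerDl.
by apply: sumr_ge0 => x _; rewrite invr_ge0.
Qed.

(** With [y = x / e] this is [y <= 1 + y ^+ 4]; the two squares in the proof add up to
    [y ^+ 4 - y + 1 / 2]. *)
Let le_eps_exp4 (e x : R) : 0 < e -> x <= e + e^-1 ^+ 3 * x ^+ 4.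
Proof.
move=> e0; pose y := x / e.
have -> : e + e^-1 ^+ 3 * x ^+ 4 = e * (1 + y ^+ 4).
  by rewrite /y; field; rewrite gt_eqF.
have -> : x = e * y by rewrite /y; field; rewrite gt_eqF.
rewrite ler_pM2l//.
have h1 : 0 <= (y ^+ 2 - 2^-1) ^+ 2 by exact: sqr_ge0.
have h2 : 0 <= (y - 2^-1) ^+ 2 by exact: sqr_ge0.
nra.
Qed.

Let reward_sum_le n w : \sum_(t < n) reward_at M w t <=
  mart n w + \sum_(t < n) g (w t).1 + h (w 0).1 - h (w n).1.
Proof.
elim: n => [|n IH]; first by rewrite /mart !big_ord0; lra.
rewrite !big_ord_recr martS /=; have := gh_super (w n).1 (w n).2.
by rewrite /xi meanD /reward_at; lra.
Qed.

(* Pathwise, the average of the first [T] rewards is at most [g (s_m)] plus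
   the upward jumps of [g] after time [m], plus [mart T w / T] and a vanishing
   term. A jump is at most a constant times its square, and the squares of the
   jumps and the fourth powers of [mart t w / t] are summable in mean, so that
   their tails are negligible for [m] large. *)
Lemma average_return_le :
  (average_return M pi P <= (mean (initial M) g)%:E)%E.
Proof.
have [k k0 hk] := mart_moments.
have [C hC] := jump_sum.
have [l l0 hl] := jump_scale.
have [B B0 hB] := avg_reward_bound M.
have [G G0 hG] := fin_bound g.
have [H H0 hH] := fin_bound h.
have hG' s : - G <= g s <= G by rewrite -ler_norml.
have hH' s : - H <= h s <= H by rewrite -ler_norml.
(* One [e] is for [le_eps_exp4], one for the boundary terms, and [integral_limn_esup_le] doubles
   their sum. *)
apply/lee_addgt0Pr => e2 e20; pose e := e2 / 4.
have e0 : 0 < e by rewrite /e; lra.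
pose Z t w := l * jump t w + e^-1 ^+ 3 * (mart t w / t%:R) ^+ 4.
have Zloc t : local t.+2 (Z t).
  move=> w w' ww'; rewrite /Z /jump !ww'// (mart_local (w' := w'))//.
  by move=> u ut; apply: ww'; exact: ltnW.
have e3 : 0 <= e^-1 ^+ 3 by rewrite exprn_ge0// invr_ge0 ltW.
have Z0 t w : 0 <= Z t w.
  rewrite addr_ge0// mulr_ge0// ?sqr_ge0//.
  by rewrite -[4%N]/(2 * 2)%N exprM sqr_ge0.
have ZE t : Ex t.+2 (Z t) <= l * Ex t.+2 (jump t) +
    e^-1 ^+ 3 * (7 * k ^+ 4) * (t%:R^-1) ^+ 2.
  rewrite /Ex pexpD !pexpZ lerD2l -mulrA ler_wpM2l//.
  rewrite (_ : pexp _ _ _ _ _ = (t%:R^-1) ^+ 4 *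
    pexp M pi P t.+2 (fun w => mart t w ^+ 4)); last first.
    by rewrite -pexpZ; apply: eq_hexp => w _; rewrite exprMn mulrC.
  rewrite pexp_local; last first.
    by move=> w w' ww'; rewrite (mart_local ww').
  have [->|t0] := eqVneq t 0%N; first by rewrite invr0 !expr0n/= mul0r mulr0.
  have /(ler_wpM2l (_ : 0 <= (t%:R^-1 : R) ^+ 4)) := hk t.
  rewrite exprn_ge0 ?invr_ge0// => /(_ isT) /le_trans; apply.
  rewrite le_eqVlt; apply/orP; left; apply/eqP; field.
  by rewrite pnatr_eq0.
have Zsum n : \sum_(t < n) Ex t.+2 (Z t) <=
    l * C + e^-1 ^+ 3 * (7 * k ^+ 4) * 2.
  apply: le_trans (ler_sum _ (fun (t : 'I_n) _ => ZE t)) _.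
  rewrite big_split/= -!mulr_sumr lerD//.
    by rewrite ler_wpM2l// hC.
  rewrite ler_wpM2l ?sum_inv_sqr_le// mulr_ge0// mulr_ge0//.
  by rewrite exprn_ge0.
have Gloc m : local m.+1 (fun w : nat -> S * A => g (w m).1).
  by move=> w w' ww'; rewrite ww'.
rewrite -EFinD (_ : _ + e2 = mean (initial M) g + 2 * (2 * e)); last first.
  by rewrite /e; lra.
apply: (@integral_limn_esup_le _ _ _ (rmdp_law M pi P)
  (fun n w => n.+1%:R^-1 * \sum_(t < n.+1) reward_at M w t)
  (fun m w => g (w m).1) Z (fun t => Ex t.+2 (Z t))
  (mean (initial M) g) (B + G) (l * C + e^-1 ^+ 3 * (7 * k ^+ 4) * 2) (2 * e)).
- by move=> n; apply: local_measurable; exact: avg_reward_local.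
- by move=> n w; apply: le_trans (hB n w) _; rewrite lerDl.
- by move=> m; apply: (@local_measurable _ _ m.+1); exact: Gloc.
- by move=> m w; apply: le_trans (hG _) _; rewrite lerDr.
- move=> m; rewrite (integral_pexp M pi P (@Gloc m)) lee_fin.
  exact: (state_exp_le M pi m g_super).
- by move=> t; apply: local_measurable; exact: Zloc.
- exact: Z0.
- by move=> t; exact: integral_pexp.
- exact: Zsum.
- by rewrite mulr_gt0.
move=> m w.
(* [2 * G * m%:R] pays for the times before [m], where [g] is only known to be bounded, and [2 * H]
   for the end values of [h]. *)
have [N _ hN] : \forall n \near \oo, (2 * G * m%:R + 2 * H) / e <= n%:R :> R.
  exact: nbhs_infty_ger.
exists (maxn N m) => // n /=; rewrite geq_max => /andP[Nn mn].
have {hN Nn} := hN n Nn; rewrite /= ler_pdivrMr// => hn.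
set T := n.+1; have T0 : 0 < T%:R :> R by [].
have nT : n%:R <= T%:R :> R by rewrite ler_nat.
pose D := \sum_(m <= t < T) l * jump t w.
have jump0 t : 0 <= l * jump t w by rewrite mulr_ge0// sqr_ge0.
have D0 : 0 <= D by apply: sumr_ge0.
have gm t : (m <= t)%N -> (t <= T)%N -> g (w t).1 <= g (w m).1 + D.
  move=> mt tT; apply: (@le_trans _ _
      (g (w m).1 + \sum_(m <= u < t) l * jump u w)).
    rewrite -lerBlDl -(telescope_sumr (fun u => g (w u).1) mt).
    by apply: ler_sum => u _; exact: hl.
  rewrite lerD2l /D (big_cat_nat mt tT)/= lerDl; exact: sumr_ge0.
have gsum : \sum_(t < T) g (w t).1 <= T%:R * (g (w m).1 + D) + 2 * G * m%:R.
  have cnt j : \sum_(t < j) (t < m)%N%:R <= m%:R :> R.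
    suff -> : \sum_(t < j) (t < m)%N%:R = (minn j m)%:R :> R.
      by rewrite ler_nat geq_minr.
    elim: j => [|j IHj]; first by rewrite big_ord0 min0n.
    rewrite big_ord_recr/= IHj -natrD; congr (_%:R).
    by have [jm|mj] := ltnP j m; lia.
  apply: (@le_trans _ _
      (\sum_(t < T) ((g (w m).1 + D) + 2 * G * (t < m)%N%:R))).
    apply: ler_sum => t _; have [tm|mt] := ltnP t m.
      have /andP[? ?] := hG' (w t).1; have /andP[? ?] := hG' (w m).1.
      by rewrite mulr1; lra.
    by rewrite mulr0 addr0; apply: gm => //; exact: ltnW.
  rewrite big_split/= sumr_const card_ord -mulr_sumr -[_ *+ T]mulr_natl lerD2l.
  have G2 : 0 <= 2 * G by rewrite mulr_ge0.
  exact: (ler_wpM2l G2 (cnt T)).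
(* The sum extends to [T = n.+1], whose term supplies the fourth power of the martingale. *)
have ZD : D + e^-1 ^+ 3 * (mart T w / T%:R) ^+ 4 <= \sum_(m <= t < n.+2) Z t w.
  rewrite big_nat_recr/=; last exact: leqW.
  rewrite lerD//.
    apply: ler_sum => t _; rewrite /Z lerDl mulr_ge0//.
    by rewrite -[4%N]/(2 * 2)%N exprM sqr_ge0.
  by rewrite /Z lerDr.
have mT := le_eps_exp4 (mart T w / T%:R) e0.
apply: (@le_trans _ _ (mart T w / T%:R + (g (w m).1 + D) + e)); last first.
  by move: ZD mT; lra.
rewrite ler_pdivrMl//.
have -> : T%:R * (mart T w / T%:R + (g (w m).1 + D) + e) =
    mart T w + T%:R * (g (w m).1 + D) + T%:R * e.
  by field; rewrite gt_eqF.
have := reward_sum_le T w; have /andP[? ?] := hH' (w 0).1.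
have /andP[? ?] := hH' (w T).1; move: gsum.
have := ler_wpM2r (ltW e0) nT; lra.
Qed.

End average_upper_bound.

(** * Returns of stationary deterministic policies *)

Section stationary.
Context (R : realType) (S A : finPointedType) (M : rmdp R S A).
Variables (sigma : S -> A) (P : transitions R S A).

Definition stationary_kernel s : fdist R S := P s (sigma s).

Definition stationary_reward s : R :=
  mean (P s (sigma s)) (reward M s (sigma s)).

Let pi : policy R S A := stationary_deterministic R sigma.
Let Q := stationary_kernel.
Let rho := stationary_reward.
Let st := state_exp M pi P.

Lemma pexp_action t (F : S * A -> R) :
  pexp M pi P t.+1 (fun w => F (w t)) = st t (fun s => F (s, sigma s)).
Proof.
rewrite /st /state_exp /pexp /=; apply: eq_hexp => h hn.
rewrite !mean_pair; apply: eq_mean => s.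
rewrite /pi /stationary_deterministic !mean_dirac.
by rewrite !nth_rcons hn ltnn eqxx.
Qed.

Lemma stationary_expS t u : st t.+1 u = st t (fun s => mean (Q s) u).
Proof.
by rewrite /st state_expS (pexp_action t (fun x => mean (P x.1 x.2) u)).
Qed.

Lemma reward_exp t : pexp M pi P t.+2 (reward_at M ^~ t) = st t rho.
Proof.
rewrite (pexp_next M pi P (f := fun=> 0) (n := t)
  (fun _ x s => reward M x.1 x.2 s))//.
by rewrite (pexp_action t (fun x => mean (P x.1 x.2) (reward M x.1 x.2))).
Qed.

Lemma integral_reward t :
  (\int[rmdp_law M pi P]_w (reward_at M w t)%:E = (st t rho)%:E)%E.
Proof.
by rewrite (integral_pexp M pi P (@reward_at_local _ _ _ M t)) reward_exp.
Qed.

Lemma reward_integrable t : (rmdp_law M pi P).-integrable setT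
  (EFin \o (reward_at M ^~ t : traj (S * A)%type -> R)).
Proof. exact: local_integrable (@reward_at_local _ _ _ M t). Qed.

Lemma integral_weighted_rewards n (a : nat -> R) :
  (\int[rmdp_law M pi P]_w (\sum_(t < n) a t * reward_at M w t)%:E =
   (\sum_(t < n) a t * st t rho)%:E)%E.
Proof.
under eq_integral do rewrite -sumEFin.
rewrite (@integral_sum _ (traj (S * A)%type) R (rmdp_law M pi P) setT
  measurableT 'I_n (fun t w => (a t * reward_at M w t)%:E)); last first.
  move=> t; exact: (integrableZl measurableT (a t) (reward_integrable t)).
rewrite -sumEFin; apply: eq_bigr => t _.
under eq_integral do rewrite EFinM.
by rewrite integralZl ?integral_reward ?EFinM//; exact: reward_integrable.
Qed.

Lemma state_expB t u v : st t (fun s => u s - v s) = st t u - st t v.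
Proof. exact: pexpB. Qed.

(** The mean of the average reward converges to the initial mean of [g] by telescoping. Fatou's
    lemma for the nonnegative functions [B - f n] then moves the limit superior inside the
    integral. *)
Lemma average_return_ge g h : gain_bias Q rho g h ->
  ((mean (initial M) g)%:E <= average_return M pi P)%E.
Proof.
move=> gh.
have stg t : st t g = mean (initial M) g.
  elim: t => [|t IH]; first exact: state_exp0.
  rewrite stationary_expS -IH /st /state_exp; apply: eq_hexp => w _.
  by rewrite -(gh _).1.
have rhoE n : \sum_(t < n) st t rho =
    n%:R * mean (initial M) g + mean (initial M) h - st n h.
  elim: n => [|n IH].
    by rewrite big_ord0 /st state_exp0 mul0r add0r subrr.
  rewrite big_ord_recr/= IH.
  have -> : st n rho = st n g - (st n.+1 h - st n h).
    rewrite stationary_expS -!state_expB; apply: eq_hexp => w _ /=.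
    by have := (gh (nth point w n).1).2; lra.
  by rewrite stg -natr1; lra.
have [B B0 hB] := avg_reward_bound M.
have [C C0 hC] := fin_bound h.
pose a := mean (initial M) g.
pose f n (w : traj (S * A)%type) : R :=
  n.+1%:R^-1 * \sum_(t < n.+1) reward_at M w t.
have mf n : measurable_fun setT (f n).
  by apply: local_measurable; exact: avg_reward_local.
have intf n : (\int[rmdp_law M pi P]_w (f n w)%:E =
    (a + n.+1%:R^-1 * (mean (initial M) h - st n.+1 h))%:E)%E.
  under eq_integral do rewrite /f mulr_sumr.
  rewrite (integral_weighted_rewards n.+1 (fun=> n.+1%:R^-1)) -mulr_sumr rhoE.
  by congr EFin; rewrite /a; field.
pose c n : R := a + n.+1%:R^-1 * (mean (initial M) h - st n.+1 h).
have cvgc : c @ \oo --> a.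
  apply/cvgrPdist_le => e e0.
  have [N _ hN] : \forall n \near \oo, (2 * C) / e <= n%:R :> R.
    exact: nbhs_infty_ger.
  exists N => // n /= Nn; rewrite /c opprD addrA subrr sub0r normrN normrM.
  rewrite ger0_norm ?invr_ge0// ler_pdivrMl//.
  apply: (@le_trans _ _ (2 * C)).
    apply: le_trans (ler_normB _ _) _; rewrite mulr_natl mulr2n lerD//.
      exact: normr_mean_le.
    exact: normr_state_exp_le.
  have := hN n Nn; rewrite /= ler_pdivrMr// => /le_trans; apply.
  by rewrite ler_wpM2r ?(ltW e0)// ler_nat.
have If n := bounded_fun_integrable (rmdp_law M pi P) (mf n) (hB n).
have IB : (rmdp_law M pi P).-integrable setT (EFin \o cst B).
  exact: finite_measure_integrable_cst.
have IL := limn_esup_integrable (rmdp_law M pi P) mf hB.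
have EB : (\int[rmdp_law M pi P]_w (EFin \o cst B) w = B%:E)%E.
  have eT : (B%:E * rmdp_law M pi P setT = B%:E)%E.
    by rewrite probability_setT mule1.
  exact: etrans (integral_cst (rmdp_law M pi P) measurableT B%:E) eT.
have fB n w : (0 <= (B%:E - (f n w)%:E))%E.
  rewrite -EFinB lee_fin subr_ge0; exact: le_trans (ler_norm _) (hB n w).
have mfB n : measurable_fun [set: traj (S * A)%type]
    (fun w => B%:E - (f n w)%:E)%E.
  by apply: emeasurable_funB => //; exact/measurable_EFinP.
have := fatou (rmdp_law M pi P) measurableT mfB (fun n w _ => fB n w).
have -> : (fun n => \int[rmdp_law M pi P]_w (B%:E - (f n w)%:E))%E =
    (fun n => (B - c n)%:E).
  apply/funext => n; rewrite EFinB -[in RHS]EB.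
  apply: etrans (integralB measurableT IB (If n)) _; congr (_ - _)%E.
  exact: intf.
have Bc : (B - c n)%:E @[n --> \oo] --> (B - a)%:E.
  by apply: cvg_EFin; [exact: nearW|apply: cvgB => //; exact: cvg_cst].
have [-> _] := cvg_limn_einf_sup Bc.
have -> : (\int[rmdp_law M pi P]_w limn_einf (fun n => B%:E - (f n w)%:E) =
    B%:E - average_return M pi P)%E.
  rewrite -[in RHS]EB; apply: etrans (integralB measurableT IB IL).
  apply: eq_integral => w _; rewrite limn_einf_shift//; congr (_ + _)%E.
  exact: limn_einfN.
have fin : average_return M pi P \is a fin_num by exact: integrable_fin_num IL.
rewrite -(fineK fin) -EFinB !lee_fin /a; lra.
Qed.

(** Iterating the equation of [V] gives the means of the partial sums, and dominated convergence
    gives their limit; the quotient undoes the normalization of [V]. *)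
Lemma discounted_returnE gamma V : 0 < gamma -> gamma < 1 ->
  discounted_value (1 - gamma) Q rho V ->
  discounted_return M gamma pi P =
  (mean (initial M) V / (1 - gamma))%:E.
Proof.
move=> g0 g1 VE; have g1' : 0 < 1 - gamma by lra.
have [B B0 hB] := fin_bound (fun x : S * A * S => reward M x.1.1 x.1.2 x.2).
have hr w t : `|reward_at M w t| <= B by exact: (hB (w t, (w t.+1).1)).
have [C C0 hC] := fin_bound V.
pose f n (w : traj (S * A)%type) : R :=
  \sum_(t < n) gamma ^+ t * reward_at M w t.
pose b := B / (1 - gamma).
have gn : `|gamma| < 1 by rewrite ger0_norm// ltW.
have term w t : `|gamma ^+ t * reward_at M w t| <= geometric B gamma t.
  rewrite normrM normrX (ger0_norm (ltW g0)) /= mulrC.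
  by rewrite ler_wpM2r// exprn_ge0// ltW.
have fE w : (fun n => f n w) = series (fun t => gamma ^+ t * reward_at M w t).
  by apply/funext => n; rewrite /series/= big_mkord.
have fcvg w : cvgn (fun n => f n w).
  rewrite fE; apply: normed_cvg; apply: series_le_cvg (term w) _ => //.
  - by move=> t; rewrite /= mulr_ge0// exprn_ge0// ltW.
  - exact: is_cvg_geometric_series.
have fb n w : `|f n w| <= b.
  apply: le_trans (ler_norm_sum _ _ _) _.
  apply: le_trans (ler_sum _ (fun (t : 'I_n) _ => term w t)) _.
  have := geometric_seriesE B (negbT (lt_eqF g1)) => /(congr1 (@^~ n)).
  rewrite /series/= big_mkord => ->.
  rewrite /b ler_wpM2r ?invr_ge0 ?(ltW g1')//.
  by rewrite ler_piMr// gerBl exprn_ge0// ltW.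
have mf n : measurable_fun [set: traj (S * A)%type] (f n).
  apply: measurable_sum => t; apply: measurable_funM => //.
  exact: local_measurable (@reward_at_local _ _ _ M t).
have intf n : (\int[rmdp_law M pi P]_w (f n w)%:E =
    ((mean (initial M) V - gamma ^+ n * st n V) / (1 - gamma))%:E)%E.
  rewrite (integral_weighted_rewards n (fun t => gamma ^+ t)); congr EFin.
  elim: n => [|n IH].
    by rewrite big_ord0 expr0 mul1r /st state_exp0 subrr mul0r.
  have stV : st n V = (1 - gamma) * st n rho + gamma * st n.+1 V.
    rewrite stationary_expS /st /state_exp -!pexpZ -pexpD.
    by apply: eq_hexp => w _; rewrite {1}VE; congr (_ + _ * _); lra.
  rewrite big_ord_recr/= IH stV exprS; field.
  by rewrite gt_eqF.
have flim : (mean (initial M) V - gamma ^+ n * st n V) / (1 - gamma)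
    @[n --> \oo] --> mean (initial M) V / (1 - gamma).
  apply: cvgMl; rewrite -[X in _ --> X]subr0; apply: cvgB; first exact: cvg_cst.
  apply: norm_cvg0; apply: (@squeeze_cvgr _ _ _ _ (cst 0) (geometric C gamma)).
  - apply: nearW => n; rewrite normr_ge0 normrM /= mulrC ler_pM//.
      exact: normr_state_exp_le.
    by rewrite normrX (ger0_norm (ltW g0)).
  - exact: cvg_cst.
  - exact: cvg_geometric.
have [] := @dominated_convergence _ _ _ (rmdp_law M pi P) setT measurableT
  (fun n w => (f n w)%:E) (fun w => (limn (fun n => f n w))%:E) (EFin \o cst b).
- by move=> n; exact/measurable_EFinP.
- by apply/measurable_EFinP; apply: (measurable_fun_cvg (h := f)).
- by apply: aeW => w _; apply: cvg_EFin; [exact: nearW|exact: fcvg].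
- exact: finite_measure_integrable_cst.
- by apply: aeW => w n _; rewrite /= lee_fin.
move=> _ _ dc; rewrite /discounted_return unlock.
have -> : (\int[rmdp_law M pi P]_w
    (limn (series (fun t => gamma ^+ t * reward_at M w t)))%:E =
    \int[rmdp_law M pi P]_w (limn (fun n => f n w))%:E)%E.
  by apply: eq_integral => w _; rewrite fE.
apply: (cvg_unique _ dc) => //.
rewrite (_ : [sequence _]_n = fun n =>
  ((mean (initial M) V - gamma ^+ n * st n V) / (1 - gamma))%:E); last first.
  by apply/funext => n; exact: intf.
by apply: cvg_EFin => //; exact: nearW.
Qed.

End stationary.

(** * Robust Markov decision processes *)

Section gain.
Context (R : realType) (T : finType).
Implicit Types (Q : T -> fdist R T) (rho g h : T -> R).

Lemma discounted_value_bound Q rho l V B : 0 < l -> l <= 1 ->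
  (forall s, `|rho s| <= B) -> discounted_value l Q rho V ->
  forall s, `|V s| <= B.
Proof.
move=> l0 l1 hB VE s.
have hB' t : l * - B <= l * rho t <= l * B.
  by have := hB t; rewrite ler_norml !ler_pM2l.
rewrite ler_norml; apply/andP; split.
  rewrite -lerN2 opprK.
  apply: (@discounted_max_principle _ _ Q l _ (fun t => - V t)) => // t.
  by rewrite meanN {1}VE; have /andP[] := hB' t; lra.
apply: (@discounted_max_principle _ _ Q l) => // t.
by rewrite {1}VE; have /andP[] := hB' t; lra.
Qed.

(** Discounted values obey the bound, and they tend to the gain. *)
Lemma gain_bound Q rho g h B : (forall s, `|rho s| <= B) ->
  gain_bias Q rho g h -> forall s, `|g s| <= B.
Proof.
move=> hB gh s; have [C C0 hC] := fin_bound h.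
apply: (@le_eps_small _ _ _ (2 * C)) => d d0.
pose l := Num.min (d / 2) 1.
have l0 : 0 < l by rewrite /l lt_min; apply/andP; split; lra.
have l1 : l <= 1 by rewrite /l ge_min lexx orbT.
have ld : l < d by rewrite /l gt_min; apply/orP; left; lra.
exists l; split=> //.
have [V VE] := discounted_value_ex Q rho l0 l1.
have h1 := abel_estimate l0 l1 gh hC VE s.
have h2 := discounted_value_bound l0 l1 hB VE s.
have := ler_normB (V s) (V s - g s); rewrite opprB addrCA subrr addr0; lra.
Qed.

(** The difference of the two solutions solves the equations with zero reward, so [gain_bound]
    applies with bound 0. *)
Lemma gain_bias_unique Q rho g h g' h' : gain_bias Q rho g h ->
  gain_bias Q rho g' h' -> forall s, g s = g' s.
Proof.
move=> gh gh' s.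
have d : gain_bias Q (fun=> 0) (fun s => g s - g' s) (fun s => h s - h' s).
  move=> t; rewrite !meanB -(gh t).1 -(gh' t).1; split=> //.
  by have := (gh t).2; have := (gh' t).2; lra.
have := @gain_bound Q (fun=> 0) _ _ 0 _ d s.
by rewrite normr0 normr_le0 subr_eq0 => /(_ (fun=> lexx _))/eqP.
Qed.

Definition gain Q rho : T -> R := projT1 (cid (gain_bias_ex Q rho)).

Lemma gainP Q rho : exists h, gain_bias Q rho (gain Q rho) h.
Proof. by rewrite /gain; case: cid. Qed.

Lemma gainE Q rho g h : gain_bias Q rho g h -> forall s, gain Q rho s = g s.
Proof. by have [h' gh'] := gainP Q rho; exact: gain_bias_unique. Qed.

(* The first [n] rewards are compared to the discounted value at a state that
   maximizes [w - V]; there [Q^n V >= V], as [w] is subharmonic. *)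
Lemma discounted_value_lower Q rho w V l B e n : 0 < l -> l <= 1 ->
  discounted_value l Q rho V -> (forall s, `|rho s| <= B) ->
  (forall s, w s <= mean (Q s) w) ->
  (0 < n)%N -> 2 * B * n%:R * l <= e ->
  (forall s, n%:R * (w s - e) <=
    \sum_(t < n) iter t (transport Q) rho s) ->
  forall s, w s - 2 * e <= V s.
Proof.
move=> l0 l1 VE hB wQ n0 nl ces s0.
have [s _ smax'] := @arg_maxP _ _ _ s0 xpredT (fun s => w s - V s) isT.
have smax t : w t - V t <= w s - V s by exact: smax'.
suff H : w s - 2 * e <= V s by have := smax s0; lra.
have B0 : 0 <= B by exact: le_trans (normr_ge0 _) (hB s).
have l1' : 0 <= 1 - l by lra.
have VB := discounted_value_bound l0 l1 hB VE s.
have QV : V s <= iter n (transport Q) V s.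
  have h1 := iter_transport_subharmonic n wQ s.
  have : iter n (transport Q) (fun t => w t - V t) s <= w s - V s.
    rewrite -[leRHS](iter_transport_cst Q _ n s).
    by apply: iter_transport_le => t; exact: smax.
  by rewrite iter_transportB; lra.
have bern m : 1 - m%:R * l <= (1 - l) ^+ m.
  elim: m => [|m IH]; first by rewrite expr0; lra.
  rewrite exprS -natr1; apply: le_trans (ler_wpM2l l1' IH).
  have : 0 <= m%:R * (l * l) by rewrite mulr_ge0// mulr_ge0// ltW.
  by lra.
have geo m : l * \sum_(t < m) (1 - l) ^+ t = 1 - (1 - l) ^+ m.
  elim: m => [|m IH]; first by rewrite big_ord0 expr0; lra.
  by rewrite big_ord_recr/= mulrDr IH exprS; lra.
(* [V s] is unrolled over [n] steps, and [QV] bounds the remainder from below by [V s]. *)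
have step : 0 <= \sum_(t < n) (1 - l) ^+ t *
    (V s - iter t (transport Q) rho s).
  rewrite -(pmulr_rge0 _ l0).
  have -> : \sum_(t < n) (1 - l) ^+ t * (V s - iter t (transport Q) rho s) =
      V s * (\sum_(t < n) (1 - l) ^+ t) -
      \sum_(t < n) (1 - l) ^+ t * iter t (transport Q) rho s.
    rewrite mulr_sumr -sumrB; apply: eq_bigr => t _; ring.
  have := discounted_value_iter n VE s.
  have : (1 - l) ^+ n * V s <= (1 - l) ^+ n * iter n (transport Q) V s.
    by rewrite ler_wpM2l// exprn_ge0.
  have := geo n; nra.
(* Replacing a weight by 1 costs at most [2 * B * n%:R * l]: the weight is within [n%:R * l] of 1,
   and the bracket is at most [2 * B] in absolute value. *)
have bnd : \sum_(t < n) (1 - l) ^+ t * (V s - iter t (transport Q) rho s) <=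
    \sum_(t < n) ((V s - iter t (transport Q) rho s) + 2 * B * n%:R * l).
  apply: ler_sum => t _.
  have := bern t; set y := (1 - l) ^+ t => hy.
  have y1 : y <= 1 by rewrite exprn_ile1//; lra.
  have tn : t%:R <= n%:R :> R by rewrite ler_nat ltnW.
  have tl : t%:R * l <= n%:R * l by rewrite ler_wpM2r// ltW.
  have := iter_transport_bound Q t hB s; move: VB.
  rewrite !ler_norml => /andP[a1 a2] /andP[b1 b2].
  set x := iter t _ _ _ in b1 b2 *.
  have h1 : (1 - y) * (- (V s - x)) <= (1 - y) * (2 * B).
    by apply: ler_wpM2l; lra.
  have h2 : (1 - y) * (2 * B) <= n%:R * l * (2 * B).
    by apply: ler_wpM2r; [rewrite mulr_ge0|lra].
  lra.
have := ces s; have := le_trans step bnd.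
rewrite big_split/= sumrB !sumr_const card_ord -[V s *+ n]mulr_natl.
rewrite -[_ *+ n]mulr_natl => h1 h2.
have n0' : 0 < n%:R :> R by rewrite ltr0n.
rewrite -(ler_pM2l n0').
have := ler_wpM2l (ltW n0') nl; lra.
Qed.

End gain.

Lemma cvg_fsum (R : realType) (T : Type) (F : set_system T) {FF : Filter F}
    (I : finType) (f : I -> T -> R) (a : I -> R) :
  (forall i, f i x @[x --> F] --> a i) ->
  \sum_i f i x @[x --> F] --> \sum_i a i.
Proof.
move=> fa; elim: (index_enum I) => [|i r IH].
  under eq_fun do rewrite big_nil.
  by rewrite big_nil; exact: cvg_cst.
under eq_fun do rewrite big_cons.
by rewrite big_cons; exact: cvgD.
Qed.

(** * Robust gains and worst cases of stationary policies *)

Section robust.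
Context (R : realType) (S A : finPointedType) (M : rmdp R S A).
Hypothesis M_rect : sa_rectangular M.
Local Notation U := (uncertainty M).
Implicit Types (sigma : S -> A) (P : transitions R S A).

(** Rectangularity enters here: members of [U] may be recombined pair by pair. *)
Let U_sel (I : Type) (F : I -> transitions R S A) (i : S -> A -> I) :
  (forall j, U (F j)) -> U (fun s a => F (i s a) s a).
Proof. by have [V ->] := M_rect => UF s a; exact: UF. Qed.

Let reward_bound : exists2 B : R, 0 <= B &
  forall sigma P s, `|stationary_reward M sigma P s| <= B.
Proof.
have [B B0 hB] := fin_bound (fun x : S * A * S => reward M x.1.1 x.1.2 x.2).
exists B => // sigma P s; apply: normr_mean_le => s'.
exact: (hB (s, sigma s, s')).
Qed.

Definition chain_gain sigma P : S -> R :=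
  gain (stationary_kernel sigma P) (stationary_reward M sigma P).

Definition robust_gain sigma s : R := inf [set chain_gain sigma P s | P in U].

Let has_inf_gain sigma s : has_inf [set chain_gain sigma P s | P in U].
Proof.
have [B B0 hB] := reward_bound; split.
  by have [P UP] := uncertainty_nonempty M; exists (chain_gain sigma P s), P.
exists (- B) => _ [P UP <-].
have [h gh] := gainP (stationary_kernel sigma P) (stationary_reward M sigma P).
by have := gain_bound (hB sigma P) gh s; rewrite ler_norml => /andP[].
Qed.

Lemma robust_gain_le sigma P s :
  U P -> robust_gain sigma s <= chain_gain sigma P s.
Proof.
by move=> UP; apply: inf_lbound; [exact: (has_inf_gain sigma s).2|exists P].
Qed.

(** A game in which only the adversary chooses, among a near-minimizer for each state, yields one
    [Q] that is nearly minimal at all states at once. Offering [P] as the option [None] makes the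
    gain of [Q] subharmonic for [P]. *)
Lemma robust_gain_approx sigma P e : U P -> 0 < e ->
  exists Q, [/\ U Q, forall s, chain_gain sigma Q s <= robust_gain sigma s + e &
    forall s,
      chain_gain sigma Q s <= mean (P s (sigma s)) (chain_gain sigma Q)].
Proof.
move=> UP e0.
have /choice[F hF] : forall s, exists Q, U Q /\
    chain_gain sigma Q s < robust_gain sigma s + e.
  move=> s; have [_ [Q UQ <-] Qe] := inf_adherent e0 (has_inf_gain sigma s).
  by exists Q.
pose G (i : option S) := if i is Some s then F s else P.
have UG i : U (G i) by case: i => //= s; exact: (hF s).1.
have [tau [iota [g [[h gh] _ gP gF _]]]] := @finite_game R S unit (option S)
  tt None (fun i s _ => stationary_kernel sigma (G i) s)
  (fun i s _ => stationary_reward M sigma (G i) s).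
pose Q : transitions R S A := fun s a => G (iota (s, tt)) s a.
have gE s : chain_gain sigma Q s = g s.
  apply: (@gainE _ _ _ _ g h) => t; have := gh t.
  by case: (tau t).
exists Q; split.
- exact: (U_sel (fun s _ => iota (s, tt)) UG).
- move=> s; rewrite gE; apply: le_trans (ltW (hF s).2).
  have [h' gh'] := gainP (stationary_kernel sigma (F s))
    (stationary_reward M sigma (F s)).
  exact: (gF (Some s) _ h').
- move=> s; rewrite gE (eq_mean _ gE); exact: (gP s None).
Qed.

Lemma robust_gain_subharmonic sigma P s : U P ->
  robust_gain sigma s <= mean (P s (sigma s)) (robust_gain sigma).
Proof.
move=> UP; apply/ler_addgt0Pr => e e0.
have [Q [UQ Qe QP]] := robust_gain_approx sigma UP e0.
apply: le_trans (robust_gain_le sigma s UQ) _; apply: le_trans (QP s) _.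
by rewrite -[X in _ + X](mean_cst (P s (sigma s)) e) -meanD; exact: le_mean.
Qed.

(** Each [P] has a horizon whose mean rewards come close to the gain, and this persists near [P];
    compactness turns the local thresholds for [l] into one, and [discounted_value_lower]
    concludes. *)
Lemma discounted_value_ge sigma e : 0 < e -> \forall l \near (0 : R)^'+,
  forall P V, U P -> discounted_value l (stationary_kernel sigma P)
    (stationary_reward M sigma P) V ->
  forall s, robust_gain sigma s - e <= V s.
Proof.
move=> e0.
have [B B0 hB] := reward_bound.
pose X := {ptws S * A * S -> R}.
(* The kernel and the reward are extended to arbitrary points of the product space, where continuity
   can be stated. *)
pose kf (f : X) (u : S -> R) s := \sum_s' f (s, sigma s, s') * u s'.
pose rf (f : X) s := \sum_s' f (s, sigma s, s') * reward M s (sigma s) s'.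
pose emb P : X := fun x => P x.1.1 x.1.2 x.2.
have embE P t s : iter t (kf (emb P)) (rf (emb P)) s = iter t
  (transport (stationary_kernel sigma P)) (stationary_reward M sigma P) s.
  elim: t s => [//|t IH] s /=; apply: eq_bigr => s' _; by rewrite IH.
have evc (f : X) x : f' x @[f' --> f] --> f x.
  exact: (@proj_continuous (S * A * S)%type (fun=> R) x f).
have itc t s (f : X) :
    iter t (kf f') (rf f') s @[f' --> f] --> iter t (kf f) (rf f) s.
  elim: t s => [|t IH] s /=.
    apply: (@cvg_fsum R X (nbhs f) _ S
      (fun s' f => f (s, sigma s, s') * reward M s (sigma s) s')) => s'.
    by apply: cvgM; [exact: evc|exact: cvg_cst].
  apply: (@cvg_fsum R X (nbhs f) _ S
    (fun s' f => f (s, sigma s, s') * iter t (kf f) (rf f) s')) => s'.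
  by apply: cvgM; [exact: evc|exact: IH].
pose good (l : R) (f : X) := exists n, [/\ (0 < n)%N,
  2 * B * n%:R * l <= e / 2 &
  forall s, n%:R * (robust_gain sigma s - e / 2) <=
    \sum_(t < n) iter t (kf f) (rf f) s].
have e20 : 0 < e / 2 by lra.
have cov : \forall l \near (0 : R)^'+, (emb @` U) `<=` good l.
  have := @uncertainty_compact _ _ _ M; rewrite compact_near_coveringP => nc.
  apply: (nc _ _ good) => _ [P UP <-].
  have [h gh] := gainP (stationary_kernel sigma P)
    (stationary_reward M sigma P).
  have [C C0 hC] := fin_bound h.
  (* The bias terms [2 * C] are strictly below [n%:R * (e / 2)], and the strict inequality survives
     on a neighbourhood. *)
  pose n := (Num.truncn (2 * C / (e / 2))).+2.
  have nC : 2 * C < n%:R * (e / 2).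
    rewrite -ltr_pdivrMr//; apply: lt_le_trans (truncnS_gt _) _.
    by rewrite ler_nat.
  have near_f : \forall f \near (emb P : X), forall s,
      n%:R * (robust_gain sigma s - e / 2) <=
      \sum_(t < n) iter t (kf f) (rf f) s.
    apply: (@filter_forall X S (fun s f =>
      n%:R * (robust_gain sigma s - e / 2) <=
      \sum_(t < n) iter t (kf f) (rf f) s) (nbhs (emb P : X))) => s.
    have sc : (fun f : X => \sum_(t < n) iter t (kf f) (rf f) s) @ (emb P : X)
        --> \sum_(t < n) iter t (kf (emb P)) (rf (emb P)) s.
      apply: (@cvg_fsum R X (nbhs (emb P : X)) _ 'I_n
        (fun t f => iter t (kf f) (rf f) s)) => t.
      exact: itc.
    apply: (cvgr_ge _ sc).
    under eq_bigr do rewrite embE.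
    rewrite (cesaro_gain n gh s).
    have := ler_wpM2l (ler0n R n) (robust_gain_le sigma s UP).
    have := hC s.
    have := iter_transport_bound (stationary_kernel sigma P) n hC s.
    rewrite !ler_norml /chain_gain => /andP[? ?] /andP[? ?]; lra.
  have near_l : \forall l \near (0 : R)^'+, 2 * B * n%:R * l <= e / 2.
    have Bn : 0 < 2 * B * n%:R + 1 by rewrite ltr_wpDl// !mulr_ge0.
    near=> l.
    apply: (@le_trans _ _ ((2 * B * n%:R + 1) * l)).
      by rewrite ler_wpM2r// lerDl.
    rewrite mulrC -ler_pdivlMr//; near: l; apply: nbhs_right_le.
    exact: divr_gt0.
  exists ([set f | forall s, n%:R * (robust_gain sigma s - e / 2) <=
      \sum_(t < n) iter t (kf f) (rf f) s],
    [set l | 2 * B * n%:R * l <= e / 2]) => //= -[f l] [/= hf hl].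
  by exists n.
near=> l => P V UP VE.
have [||n [n0 nl hn]] := near cov l _ (emb P).
- by [].
- by exists P.
have l0 : 0 < l by [].
have l1 : l <= 1 by near: l; apply: nbhs_right_le.
rewrite (_ : e = 2 * (e / 2)); last lra.
apply: (discounted_value_lower l0 l1 VE (hB sigma P) _ n0 nl).
  by move=> s; exact: robust_gain_subharmonic.
by move=> s; apply: le_trans (hn s) _; apply: ler_sum => t _; rewrite embE.
Unshelve. all: by end_near. Qed.


Definition initial_robust_gain sigma : R :=
  mean (initial M) (robust_gain sigma).

Lemma worst_case_discounted_ge sigma e : 0 < e -> \forall l \near (0 : R)^'+,
  (((initial_robust_gain sigma - e) / l)%:E <=
   worst_case M (discounted_return M (1 - l))
     (stationary_deterministic R sigma))%E.
Proof.
move=> e0; near=> l.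
have l0 : 0 < l by [].
have l1 : l < 1 by near: l; apply: nbhs_right_lt.
have ge : forall P V, U P -> discounted_value l (stationary_kernel sigma P)
    (stationary_reward M sigma P) V ->
  forall s, robust_gain sigma s - e <= V s.
  by near: l; exact: discounted_value_ge.
apply: le_ereal_inf_tmp => _ [P UP <-].
have [V VE] := discounted_value_ex (stationary_kernel sigma P)
  (stationary_reward M sigma P) l0 (ltW l1).
rewrite (@discounted_returnE _ _ _ _ _ _ (1 - l) V); [|lra|lra|]; last first.
  by rewrite subKr.
rewrite subKr lee_fin ler_pM2r ?invr_gt0// /initial_robust_gain.
rewrite -[X in _ - X](mean_cst (initial M)) -meanB; apply: le_mean => s.
exact: (ge P V UP VE).
Unshelve. all: by end_near. Qed.

(** One near-minimizer of the gain, fixed before [l], suffices, since its discounted value tends to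
    its gain. *)
Lemma worst_case_discounted_le sigma e : 0 < e -> \forall l \near (0 : R)^'+,
  (worst_case M (discounted_return M (1 - l)) (stationary_deterministic R sigma)
   <= ((initial_robust_gain sigma + e) / l)%:E)%E.
Proof.
move=> e0; have e20 : 0 < e / 2 by lra.
have [P0 UP0] := uncertainty_nonempty M.
have [P [UP Pe _]] := robust_gain_approx sigma UP0 e20.
have [h gh] := gainP (stationary_kernel sigma P) (stationary_reward M sigma P).
have [C C0 hC] := fin_bound h.
have C1 : 0 < 2 * C + 1 by lra.
have eC := divr_gt0 e20 C1.
near=> l.
have l0 : 0 < l by [].
have l1 : l < 1 by near: l; apply: nbhs_right_lt.
have lC : l * (2 * C + 1) <= e / 2.
  by rewrite -ler_pdivlMr//; near: l; exact: nbhs_right_le.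
apply: ge_ereal_inf; exists (discounted_return M (1 - l)
  (stationary_deterministic R sigma) P); first by exists P.
have [V VE] := discounted_value_ex (stationary_kernel sigma P)
  (stationary_reward M sigma P) l0 (ltW l1).
rewrite (@discounted_returnE _ _ _ _ _ _ (1 - l) V); [|lra|lra|]; last first.
  by rewrite subKr.
rewrite subKr lee_fin ler_pM2r ?invr_gt0// /initial_robust_gain.
rewrite -[X in _ + X](mean_cst (initial M)) -meanD; apply: le_mean => s.
have := abel_estimate l0 (ltW l1) gh hC VE s.
rewrite ler_norml => /andP[_]; have := Pe s; rewrite /chain_gain; lra.
Unshelve. all: by end_near. Qed.

Lemma worst_case_average_ge sigma : ((initial_robust_gain sigma)%:E <=
  worst_case M (average_return M) (stationary_deterministic R sigma))%E.
Proof.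
apply: le_ereal_inf_tmp => _ [P UP <-].
have [h gh] := gainP (stationary_kernel sigma P) (stationary_reward M sigma P).
apply: le_trans (average_return_ge gh); rewrite lee_fin.
by apply: le_mean => s; exact: robust_gain_le.
Qed.

Lemma worst_case_average_le (pi : policy R S A) e : 0 < e -> exists sigma,
  (worst_case M (average_return M) pi <= (initial_robust_gain sigma + e)%:E)%E.
Proof.
move=> e0; have e20 : 0 < e / 2 by lra.
have [P0 UP0] := uncertainty_nonempty M.
have /choice[F hF] : forall tau : {ffun S -> A}, exists P, U P /\
    forall s, chain_gain tau P s <= robust_gain tau s + e / 2.
  move=> tau; have [P [UP Pe _]] := robust_gain_approx tau UP0 e20.
  by exists P.
(* The adversary's option [tau] stands for the near-optimal answer [F tau] to the policy [tau]. *)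
have [sigma [iota [g [_ gsup _ gF gh]]]] := @finite_game R S A {ffun S -> A}
  point [ffun=> point] (fun tau s a => F tau s a)
  (fun tau s a => mean (F tau s a) (reward M s a)).
pose P : transitions R S A := fun s a => F (iota (s, a)) s a.
have UP : U P.
  by apply: (U_sel (fun s a => iota (s, a))) => tau; exact: (hF tau).1.
exists sigma; apply: ge_ereal_inf; exists (average_return M pi P).
  by exists P.
have [h hh] := gh _ e20.
(* The bias inequality holds only up to [e / 2], so [g + e / 2] takes the place of the gain. *)
have H : (average_return M pi P <=
    (mean (initial M) (fun s => g s + e / 2)%R)%:E)%E.
  apply: (@average_return_le _ _ _ _ _ _ _ h) => s a; last exact: hh.
  by rewrite meanD mean_cst lerD2r; exact: gsup.
apply: le_trans H _; rewrite lee_fin meanD mean_cst /initial_robust_gain.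
suff : mean (initial M) g <=
  mean (initial M) (robust_gain sigma) + e / 2 by lra.
rewrite -[X in _ + X](mean_cst (initial M)) -meanD; apply: le_mean => s.
apply: le_trans ((hF sigma).2 s).
(* The saddle property is used against the constant option [sigma], the answer to [sigma] itself. *)
have [h' gh'] := gainP (stationary_kernel sigma (F sigma))
  (stationary_reward M sigma (F sigma)).
exact: (gF sigma _ h' gh').
Qed.

End robust.

(** * Comparison of the finitely many stationary deterministic policies *)

Theorem theorem4p10 (R : realType) (S A : finPointedType) (M : rmdp R S A)
    (M_rect : sa_rectangular M) :
  exists gamma_avg : R, [/\ 0 <= gamma_avg, gamma_avg < 1 &
    forall gamma : R, gamma_avg < gamma -> gamma < 1 ->
    forall sigma : S -> A,
      discount_optimal M gamma (stationary_deterministic R sigma) ->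
      average_optimal M (stationary_deterministic R sigma)].
Proof.
pose G (sigma : S -> A) := initial_robust_gain M sigma.
pose W l (sigma : S -> A) :=
  worst_case M (discounted_return M (1 - l)) (stationary_deterministic R sigma).
have sep : \forall l \near (0 : R)^'+, forall x : {ffun S -> A} * {ffun S -> A},
    G x.1 < G x.2 -> (W l x.1 < W l x.2)%E.
  apply: (@filter_forall R ({ffun S -> A} * {ffun S -> A})%type
    (fun x l => G x.1 < G x.2 -> (W l x.1 < W l x.2)%E)) => -[sigma tau] /=.
  have [lt|ge] := ltP (G sigma) (G tau); last by apply: nearW => l.
  (* A third of the gap as error on either side keeps the two worst cases apart. *)
  have e0 : 0 < (G tau - G sigma) / 3 by lra.
  near=> l => _.
  have l0 : 0 < l by [].
  apply: (@le_lt_trans _ _ ((G sigma + (G tau - G sigma) / 3) / l)%:E).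
    by near: l; exact: worst_case_discounted_le.
  apply: (@lt_le_trans _ _ ((G tau - (G tau - G sigma) / 3) / l)%:E).
    by rewrite lte_fin ltr_pM2r ?invr_gt0//; lra.
  by near: l; exact: worst_case_discounted_ge.
have [d /= d0 hd] := sep.
pose c := Num.min d 1; have c0 : 0 < c by rewrite /c lt_min d0 ltr01.
have c1 : c <= 1 by rewrite /c ge_min lexx orbT.
exists (1 - c); split; [lra|lra|move=> gamma gc g1 sigma opt].
have l0 : 0 < 1 - gamma by lra.
have ld : 1 - gamma < d.
  by apply: (@lt_le_trans _ _ c); [lra|rewrite /c ge_min lexx].
have sepl (x : {ffun S -> A} * {ffun S -> A}) :
    G x.1 < G x.2 -> (W (1 - gamma)%R x.1 < W (1 - gamma)%R x.2)%E.
  by move: x; apply: hd => //=; rewrite sub0r normrN gtr0_norm.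
have finE (tau : S -> A) : tau = finfun tau :> (S -> A).
  by apply/funext => s; rewrite ffunE.
(* A policy with larger [G] would have a strictly larger discounted worst case, against the
   optimality of [sigma]. *)
have Gmax (tau : S -> A) : G tau <= G sigma.
  rewrite leNgt; apply/negP; rewrite (finE tau) (finE sigma).
  move=> /(sepl (finfun sigma, finfun tau)); rewrite /= -!finE.
  apply/negP; rewrite -leNgt /W subKr opt.
  by apply: ereal_sup_ubound; exists (stationary_deterministic R tau).
apply/eqP; rewrite eq_le; apply/andP; split.
  by apply: ereal_sup_ubound; exists (stationary_deterministic R sigma).
apply: ge_ereal_sup => _ [pi _ <-].
apply: le_trans (worst_case_average_ge M sigma).
apply/lee_addgt0Pr => e e0.
have [tau] := worst_case_average_le M_rect pi e0.
move=> /le_trans; apply; rewrite -EFinD lee_fin lerD2r; exact: Gmax.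
Unshelve. all: by end_near. Qed.
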